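(* Let $0<\alpha<1$ and $1<p<\frac1\alpha$, and set $p^*:=\frac{p}{1-\alpha p}$. Then there exists a constant $C>0$ such that for any $u\in L^1(\mathbb{R})\cap{}^{\pm}W^{\alpha,p}(\mathbb{R})$, $$\|u\|_{L^{p^*}(\mathbb{R})}\le C\|{}^{\pm}\mathcal{D}^{\alpha}u\|_{L^p(\mathbb{R})}.$$ (This holds for each of the signs $-$ and $+$.)
   Context: For $0<\alpha<1$ and $\varphi\in C_0^\infty(\mathbb{R})$: ${}^{-}D^{\alpha}\varphi(x)=\frac{1}{\Gamma(1-\alpha)}\frac{d}{dx}\int_{-\infty}^x\frac{\varphi(y)}{(x-y)^{\alpha}}dy$ and ${}^{+}D^{\alpha}\varphi(x)=\frac{-1}{\Gamma(1-\alpha)}\frac{d}{dx}\int_x^{\infty}\frac{\varphi(y)}{(y-x)^{\alpha}}dy$. For $u\in L^1(\mathbb{R})$, $v\in L^1_{loc}(\mathbb{R})$ is the left (resp. right) weak fractional derivative of $u$, $v={}^{-}\mathcal{D}^{\alpha}u$ (resp. ${}^{+}\mathcal{D}^{\alpha}u$), if $\int_{\mathbb{R}} v\varphi\,dx=\int_{\mathbb{R}} u\,{}^{+}D^{\alpha}\varphi\,dx$ (resp. with ${}^{-}D^{\alpha}\varphi$) for all $\varphi\in C_0^\infty(\mathbb{R})$. ${}^{\pm}W^{\alpha,p}(\mathbb{R})=\{u\in L^p(\mathbb{R}): {}^{\pm}\mathcal{D}^{\alpha}u\in L^p(\mathbb{R})\}$. *)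

(* Defs.v *)
From HB Require Import structures.
From mathcomp Require Import all_boot all_order all_algebra.
From mathcomp Require Import all_classical all_reals all_analysis.

Set Implicit Arguments.
Unset Strict Implicit.
Unset Printing Implicit Defensive.

Import Order.TTheory GRing.Theory Num.Theory.
Import numFieldNormedType.Exports.

Local Open Scope classical_set_scope.
Local Open Scope ring_scope.

(* [left_side] is the sign "-", [right_side] the sign "+" of the superscripts in
   ^-D^alpha, ^+D^alpha. *)
Variant side := left_side | right_side.

Definition opposite (s : side) : side :=
  match s with left_side => right_side | right_side => left_side end.

Definition Gamma (R : realType) (z : R) : R :=
  \int[lebesgue_measure]_(t in `]0%R, +oo[) (t `^ (z - 1) * expR (- t)).

Definition test_function (R : realType) : set (R -> R) :=
  [set phi | (forall (n : nat) (x : R), derivable (derive1n n phi) x 1) /\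
             compact (closure [set x | phi x != 0])].

(* The integrands take the value 0 at y = x, where the kernel is singular,
   since 0 `^ alpha = 0 for alpha != 0 and 0^-1 = 0; this point is null. *)
Definition frac_deriv (R : realType) (s : side) (alpha : R) (phi : R -> R)
    : R -> R :=
  match s with
  | left_side => fun x => (Gamma (1 - alpha))^-1 *
      derive1 (fun z => \int[lebesgue_measure]_(y in `]-oo, z])
                   (phi y / (z - y) `^ alpha)) x
  | right_side => fun x => - (Gamma (1 - alpha))^-1 *
      derive1 (fun z => \int[lebesgue_measure]_(y in `[z, +oo[)
                   (phi y / (y - z) `^ alpha)) x
  end.

(* "v is the weak fractional derivative of u"; meaningful for u in L^1, as
   then both integrals converge. *)
Definition weak_frac_deriv (R : realType) (s : side) (alpha : R)
    (u v : R -> R) : Prop :=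
  locally_integrable setT v /\
  forall phi : R -> R, test_function phi ->
    \int[lebesgue_measure]_x (v x * phi x) =
    \int[lebesgue_measure]_x (u x * frac_deriv (opposite s) alpha phi x).

Definition frac_sobolev (R : realType) (s : side) (alpha p : R)
    : set (R -> R) :=
  [set u | u \in Lfun lebesgue_measure p%:E /\
           exists2 v : R -> R, weak_frac_deriv s alpha u v &
                               v \in Lfun lebesgue_measure p%:E].

(* Main.v *)
(* Let I(x) = int_(y < x) (x - y)^(alpha - 1) |v(y)| dy be the Riesz potential of
   v and let q be the Sobolev exponent p / (1 - alpha p). The function
   (b - x)_+^alpha - (a - x)_+^alpha is, up to a constant, the fractional
   integral of the indicator function of [a, b[, so its right fractional
   derivative is a multiple of that indicator. Testing the weak derivative
   against smooth approximations of it and letting them converge bounds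
   |int_a^b u| by a constant times int_a^b I, hence |u| <= C I almost everywhere
   by Lebesgue's differentiation theorem. It remains to bound I from L^p to L^q
   (Hardy, Littlewood and Sobolev), which follows Hedberg: splitting the integral
   at the right distance from x gives I^q <= C ||v||_p^(q - p) M^p with M the
   maximal function of v, which is bounded on L^p. The other sign is reduced to
   this one by the reflection x |-> - x. *)

(* The function $(b-x)_+^\alpha-(a-x)_+^\alpha$ fails to be a test function in two ways: it is not
   smooth at [a] and [b], and it has a tail towards minus infinity. Factors [exp (- d / y)] smooth
   it and keep all its derivatives within one family of functions; the cutoff [exp (- 1 / (x + n))],
   zero for [x <= - n], removes the tail. The limit rests on bounds that do not depend on [n]. The
   derivatives of the approximations are dominated by the singular powers [(z - y)_+^(alpha - 1)]
   and a multiple of the function itself; against the kernel [(y - x)_+^(- alpha)] the singular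
   powers integrate to a Beta integral, whatever [x] is. So the fractional derivatives of the
   approximations are bounded uniformly in [n] and [x], which is what [u] in $L^1$ calls for. On the
   side of [v] no limit is taken: a bound uniform in [n] suffices and costs only a constant. In
   Hedberg's step the kernel is written as a superposition of indicators of windows [[x - s, x[], so
   that the near and the far part both reduce to the mass of [|v|] in one window. *)
Require Import Defs.
From HB Require Import structures.
From mathcomp Require Import all_boot all_order all_algebra.
From mathcomp Require Import all_classical all_reals all_analysis.
From mathcomp Require Import measurable_realfun ring lra.

Set Implicit Arguments.
Unset Strict Implicit.
Unset Printing Implicit Defensive.

Import Order.TTheory GRing.Theory Num.Theory.
Import numFieldNormedType.Exports.

Local Open Scope classical_set_scope.
Local Open Scope ring_scope.

(** * Integration on the line *)

Section integral_line.
Context {R : realType}.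
Notation mu := (@lebesgue_measure R).
Implicit Types f g : R -> \bar R.
Local Open Scope ereal_scope.

Lemma ge0_integralTZl (k : R) f : (0 <= k)%R ->
  measurable_fun setT f -> (forall x, 0 <= f x) ->
  \int[mu]_x (k%:E * f x) = k%:E * \int[mu]_x f x.
Proof. by move=> k0 mf f0; rewrite ge0_integralZl. Qed.

Lemma ge0_integralTD f g : measurable_fun setT f -> measurable_fun setT g ->
  (forall x, 0 <= f x) -> (forall x, 0 <= g x) ->
  \int[mu]_x (f x + g x) = \int[mu]_x f x + \int[mu]_x g x.
Proof. by move=> mf mg f0 g0; rewrite ge0_integralD. Qed.

Lemma ge0_le_integralT f g : measurable_fun setT f -> measurable_fun setT g ->
  (forall x, 0 <= f x) -> (forall x, f x <= g x) ->
  \int[mu]_x f x <= \int[mu]_x g x.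
Proof. by move=> mf mg f0 fg; exact: ge0_le_integral. Qed.

End integral_line.

(** * Affine changes of variables *)

Section affine.
Context {R : realType}.
Notation mu := (@lebesgue_measure R).
Implicit Types a b : R.

Definition affine a b : measurableTypeR R -> measurableTypeR R :=
  fun x => a * x + b.

Lemma measurable_affine a b : measurable_fun setT (affine a b).
Proof. by apply: measurable_funD => //; exact: measurable_funM. Qed.

Definition affine_image a b : {measure set (measurableTypeR R) -> \bar R}.
Proof. by refine (pushforward mu (affine a b)); exact: measurable_affine. Defined.

(** Lebesgue measure is determined by its values on half-open intervals. For negative [a] the
    preimage of such an interval is closed on the other side, which does not alter its length. *)
Lemma lebesgue_measure_affine a b (A : set R) : a != 0 -> measurable A ->
  mscale (NngNum (normr_ge0 a)) (affine_image a b) A = mu A.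
Proof.
move=> a0 mA; apply/esym/lebesgue_measure_unique => // _ [[c d]] _ <-.
rewrite /= /mscale /= /pushforward /affine.
have [a_lt0|a_gt0|a_eq0] := ltgtP a 0; last by rewrite a_eq0 eqxx in a0.
- rewrite (_ : _ @^-1` _ = `[(d - b) / a, (c - b) / a[%classic); last first.
    apply/seteqP; split => x /=;
      by rewrite !in_itv/= ler_ndivrMr// ltr_ndivlMr// lerBrDr ltrBlDr
        [x * a]mulrC [(_ <= d) && _]andbC.
  rewrite !lebesgue_measure_itv/= !lte_fin ltr_nM2r ?invr_lt0// ltrD2r.
  case: ifPn => _; last by rewrite mule0.
  rewrite -!EFinB -EFinM ltr0_norm//; congr EFin.
  by rewrite -mulrBl mulrCA mulNr divff// mulrN1; ring.
- rewrite (_ : _ @^-1` _ = `](c - b) / a, (d - b) / a]%classic); last first.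
    apply/seteqP; split => x /=;
      by rewrite !in_itv/= ler_pdivlMr// ltr_pdivrMr// lerBrDr ltrBlDr [x * a]mulrC.
  rewrite !lebesgue_measure_itv/= !lte_fin ltr_pM2r ?invr_gt0// ltrD2r.
  case: ifPn => _; last by rewrite mule0.
  rewrite -!EFinB -EFinM gtr0_norm//; congr EFin.
  by rewrite -mulrBl mulrCA divff// mulr1; ring.
Qed.

Lemma ge0_integral_affine (f : R -> \bar R) a b : a != 0 ->
  measurable_fun setT f -> (forall x, 0 <= f x)%E ->
  (\int[mu]_x f x = `|a|%:E * \int[mu]_x f (a * x + b)%R)%E.
Proof.
move=> a0 mf f0.
transitivity (`|a|%:E * \int[affine_image a b]_x f x)%E; last first.
  by rewrite ge0_integral_pushforward//; exact: measurable_affine.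
rewrite -[RHS](ge0_integral_mscale _ measurableT (NngNum (normr_ge0 a)))//.
apply: eq_measure_integral => A mA _; exact/esym/lebesgue_measure_affine.
Qed.

(** Positive and negative parts are transported separately and without a factor, so neither sign nor
    integrability is needed. This covers translations and the reflection. *)
Lemma integral_isometry (f : R -> \bar R) a b : `|a| = 1 ->
  measurable_fun setT f ->
  (\int[mu]_x f x = \int[mu]_x f (a * x + b)%R)%E.
Proof.
move=> a1 mf; have a0 : a != 0 by rewrite -normr_eq0 a1 oner_eq0.
rewrite integralE [RHS]integralE; congr (_ - _)%E.
- rewrite (ge0_integral_affine b a0)//; last exact: measurable_funepos.
  by rewrite a1 mul1e; apply: eq_integral => x _; rewrite (funeposE, funenegE) (funeposE, funenegE).
- rewrite (ge0_integral_affine b a0)//; last exact: measurable_funeneg.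
  by rewrite a1 mul1e; apply: eq_integral => x _; rewrite (funeposE, funenegE) (funeposE, funenegE).
Qed.

Lemma integral_reflect (F : R -> \bar R) : measurable_fun setT F ->
  (\int[mu]_x F (- x)%R = \int[mu]_x F x)%E.
Proof.
move=> mF; rewrite [RHS](@integral_isometry _ (-1) 0) ?normrN1//.
by apply: eq_integral => x _; rewrite mulN1r addr0.
Qed.

End affine.

(** * Truncated powers and their integrals *)

Section positive_power.
Context {R : realType}.
Notation mu := (@lebesgue_measure R).
Implicit Types b g s d x y : R.

(* [y_+ `^ b], truncated because [y `^ b = 1] for [y < 0]. *)
Definition ppow b y : R := if 0 < y then y `^ b else 0.

Lemma ppow_gt0E b y : 0 < y -> ppow b y = y `^ b.
Proof. by rewrite /ppow => ->. Qed.

Lemma ppow_le0E b y : y <= 0 -> ppow b y = 0.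
Proof. by rewrite /ppow leNgt => /negbTE ->. Qed.

Lemma ppow_ge0 b y : 0 <= ppow b y.
Proof. by rewrite /ppow; case: ifPn => // _; exact: powR_ge0. Qed.

Lemma measurable_ppow b : measurable_fun setT (ppow b).
Proof.
apply: measurable_fun_ifT => //; exact: measurable_fun_ltr.
Qed.

Lemma cvgr_powRN g : 0 < g -> t `^ (- g) @[t --> +oo] --> (0 : R).
Proof.
move=> g0; under eq_fun do rewrite powRN.
have : t `^ g @[t --> +oo] --> (+oo : set_system R).
  apply/cvgryPge => A; near=> t.
  have t0 : 0 < t by near: t; exact: nbhs_pinfty_gt.
  rewrite (@le_trans _ _ (Num.max A 1))// ?le_max ?lexx//.
  have M0 : 0 <= Num.max A 1 by rewrite le_max ler01 orbT.
  rewrite -[leLHS]powRr1// -[X in _ `^ X](@mulVf _ g) ?gt_eqF// powRrM.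
  rewrite ge0_ler_powR ?nnegrE ?powR_ge0 ?(ltW g0) ?(ltW t0)//.
move/gtr0_cvgV0; apply.
by near=> t; rewrite powR_gt0.
Unshelve. all: by end_near. Qed.

Lemma is_derive_powR g (t : R) : g != 0 -> 0 < t ->
  is_derive t 1 (fun t => g^-1 * t `^ g) (t `^ (g - 1)).
Proof.
move=> g0 t0; have H := is_derive1_powR g t0.
by apply: is_derive_eq; rewrite /GRing.scale/= mulrA mulVf ?mul1r.
Qed.

Lemma continuous_powR g (t : R) : 0 < t -> {for t, continuous (@powR R ^~ g)}.
Proof.
move=> t0; have [d _] := is_derive1_powR g t0.
by apply: differentiable_continuous; exact/derivable1_diffP.
Qed.

Lemma integral_powR_ge g s : 0 < g -> 0 < s ->
  (\int[mu]_(t in `[s, +oo[) (t `^ (- g - 1))%:E = (s `^ (- g) / g)%:E)%E.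
Proof.
move=> g0 s0; have gN0 : - g != 0 by rewrite oppr_eq0 gt_eqF.
pose F t : R := (- g)^-1 * t `^ (- g).
have FT : F t @[t --> +oo] --> (0 : R).
  rewrite -[X in _ --> X](mulr0 ((- g)^-1)).
  by apply: cvgM; [exact: cvg_cst|exact: cvgr_powRN].
rewrite (ge0_continuous_FTC2y _ _ FT).
- by rewrite sub0e -EFinN /F invrN mulNr opprK mulrC.
- by move=> x _; exact: powR_ge0.
- apply: continuous_in_subspaceT => x; rewrite inE/= in_itv/= andbT => sx.
  exact: continuous_powR (lt_le_trans s0 sx).
- by move=> x sx; have [] := is_derive_powR gN0 (lt_trans s0 sx).
- apply: cvg_at_right_filter; apply: cvgM; first exact: cvg_cst.
  exact: continuous_powR.
- move=> x; rewrite in_itv/= andbT => sx; rewrite derive1E.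
  by have [_ ->] := is_derive_powR gN0 (lt_trans s0 sx).
Qed.

Lemma integral_powR_itv g s d : g != 0 -> 0 < s -> s < d ->
  (\int[mu]_(t in `[s, d]) (t `^ (g - 1))%:E = (g^-1 * d `^ g - g^-1 * s `^ g)%:E)%E.
Proof.
move=> g0 s0 sd; have d0 := lt_trans s0 sd.
apply: (continuous_FTC2 (F := fun t : R => g^-1 * t `^ g)) => //.
- apply: continuous_in_subspaceT => x; rewrite inE/= in_itv/= => /andP[sx _].
  exact: continuous_powR (lt_le_trans s0 sx).
- split.
  + move=> x; rewrite in_itv/= => /andP[sx _].
    by have [] := is_derive_powR g0 (lt_trans s0 sx).
  + apply: cvg_at_right_filter; apply: cvgM; first exact: cvg_cst.
    exact: continuous_powR.
  + apply: cvg_at_left_filter; apply: cvgM; first exact: cvg_cst.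
    exact: continuous_powR.
- move=> x; rewrite in_itv/= => /andP[sx _]; rewrite derive1E.
  by have [_ ->] := is_derive_powR g0 (lt_trans s0 sx).
Qed.

(** The exponent may be negative, so the primitive is used only away from 0, on [[1 / (n + 1), d[];
    monotone convergence lets [n] grow, and [0 < g] makes the contribution of the lower end
    vanish. *)
Lemma integral_ppow_lt g d : 0 < g ->
  (\int[mu]_(t in `]-oo, d[) (ppow (g - 1) t)%:E = (g^-1 * ppow g d)%:E)%E.
Proof.
move=> g0; have [d0|d0] := leP d 0.
  rewrite (@ppow_le0E _ d)// mulr0; apply: integral0_eq => t /=.
  by rewrite in_itv/= => td; rewrite ppow_le0E// ltW// (lt_le_trans td).
pose A n : set R := `[n.+1%:R^-1, d[%classic.
have mp D : measurable_fun D (fun t => (ppow (g - 1) t)%:E).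
  by apply/measurable_EFinP; apply: measurable_funTS; exact: measurable_ppow.
transitivity (\int[mu]_(t in \bigcup_n A n) (ppow (g - 1) t)%:E)%E.
  rewrite integral_mkcond [RHS]integral_mkcond; apply: eq_integral => t _.
  rewrite !patchE; case: ifPn => [|/negP]; rewrite inE/= in_itv/= => td.
  - case: ifPn => // /negP nt; rewrite ppow_le0E// leNgt; apply/negP => t0.
    apply: nt; rewrite inE; exists (Num.truncn t^-1) => //; rewrite /A/= in_itv/= td andbT.
    by rewrite -[leRHS]invrK lef_pV2 ?posrE ?invr_gt0// ltW// truncnS_gt.
  - by case: ifPn => //; rewrite inE => -[n _]; rewrite /A/= in_itv/= => /andP[_].
have : (\int[mu]_(t in A n) (ppow (g - 1) t)%:E)%E @[n --> \oo] -->
    (\int[mu]_(t in \bigcup_n A n) (ppow (g - 1) t)%:E)%E.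
  apply: ge0_nondecreasing_set_cvg_integral => //.
  - apply/nondecreasing_seqP => n; rewrite subsetEset => t; rewrite /A/= !in_itv/=.
    move=> /andP[+ ->]; rewrite andbT; apply: le_trans.
    by rewrite lef_pV2 ?posrE// ler_nat.
  - by move=> n; exact: measurable_itv.
  - by move=> n; exact: mp.
  - by move=> n x _; rewrite lee_fin ppow_ge0.
move=> /cvg_lim <-//.
apply: cvg_lim => //.
rewrite ppow_gt0E//.
have : (g^-1 * d `^ g - g^-1 * n.+1%:R^-1 `^ g)%:E @[n --> \oo] --> (g^-1 * d `^ g)%:E.
  apply: cvg_EFin; first exact: nearW.
  rewrite -[X in _ --> X]subr0; apply: cvgB; first exact: cvg_cst.
  rewrite -[X in _ --> X](mulr0 g^-1); apply: cvgM; first exact: cvg_cst.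
  move/cvg_at_rightP: (powR_cvg0 g0); apply; split; last exact: cvg_harmonic.
  by move=> n; rewrite invr_gt0.
apply: cvg_trans; apply: near_eq_cvg; near=> n.
have nd : n.+1%:R^-1 < d by near: n; exact: (near_infty_natSinv_lt (PosNum d0)).
rewrite integral_itv_bndo_bndc// -integral_powR_itv ?gt_eqF ?invr_gt0//.
apply: eq_integral => t; rewrite inE/= in_itv/= => /andP[nt _].
by rewrite ppow_gt0E// (lt_le_trans _ nt)// invr_gt0.
Unshelve. all: by end_near. Qed.

End positive_power.

(** * The Beta integral *)

Section beta.
Context {R : realType}.
Notation mu := (@lebesgue_measure R).
Implicit Types a b s x y z : R.

Lemma ppowM b s y : 0 < s -> ppow b (s * y) = s `^ b * ppow b y.
Proof.
move=> s0; rewrite /ppow pmulr_rgt0//; case: ifPn => [y0|_]; last by rewrite mulr0.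
by rewrite powRM// ltW.
Qed.

Lemma measurable_ppow_comp d (T : measurableType d) b (f : T -> R) :
  measurable_fun setT f -> measurable_fun setT (fun t => ppow b (f t)).
Proof. by move=> mf; exact: measurableT_comp (measurable_ppow b) mf. Qed.

(** The Beta value $B(1-a,a)$: the truncation in [ppow] confines the integrand to []0, 1[]. *)
Definition beta_cst a : \bar R :=
  (\int[mu]_y (ppow (- a) y * ppow (a - 1) (1 - y))%:E)%E.

Lemma measurable_beta a x z : measurable_fun setT
  (fun y => (ppow (- a) (y - x) * ppow (a - 1) (z - y))%:E).
Proof.
apply/measurable_EFinP; apply: measurable_funM; apply: measurable_ppow_comp.
  exact: measurable_funB.
exact: measurable_funB.
Qed.

(** Under [y = x + (z - x) t] the powers of [z - x] cancel, since [- a + (a - 1) + 1 = 0]. That the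
    convolution of the two kernels is constant beyond 0 is why fractional derivative and fractional
    integral undo each other. *)
Lemma integral_beta a x z :
  (\int[mu]_y (ppow (- a) (y - x) * ppow (a - 1) (z - y))%:E =
   if (x < z)%R then beta_cst a else 0)%E.
Proof.
case: ifPn => [xz|]; last first.
  rewrite -leNgt => zx; apply: integral0_eq => y _.
  have [yx|xy] := leP y x; first by rewrite ppow_le0E ?mul0r// subr_le0.
  by rewrite [ppow _ (z - y)]ppow_le0E ?mulr0// subr_le0 (le_trans zx)// ltW.
have zx0 : 0 < z - x by rewrite subr_gt0.
rewrite (ge0_integral_affine x (lt0r_neq0 zx0)); first last.
  - by move=> y; rewrite lee_fin mulr_ge0// ppow_ge0.
  - exact: measurable_beta.
rewrite gtr0_norm// -ge0_integralZl//; first last.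
- by rewrite lee_fin ltW.
- by move=> y _; rewrite lee_fin mulr_ge0// ppow_ge0.
- apply/measurable_EFinP; apply: measurable_funM; apply: measurable_ppow_comp.
    by apply: measurable_funB => //; exact: measurable_affine.
  by apply: measurable_funB => //; exact: measurable_affine.
apply: eq_integral => y _; rewrite -EFinM; congr EFin;
rewrite addrK (_ : z - (_ + x) = (z - x) * (1 - y)); last by ring.
rewrite !ppowM// mulrACA mulrA -powRD; last by apply/implyP => _; rewrite gt_eqF.
rewrite (_ : - a + (a - 1) = - 1); last by ring.
by rewrite powR_inv1 ?ltW// -mulrA mulVKf// gt_eqF.
Qed.

Lemma integral_ppow_trunc g : 0 < g ->
  (\int[mu]_y (ppow (g - 1) y * (y < 1)%R%:R)%:E = g^-1%:E)%E.
Proof.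
move=> g0; have := integral_ppow_lt 1 g0.
rewrite ppow_gt0E// powR1 mulr1 => <-; rewrite [RHS]integral_mkcond.
apply: eq_integral => y _; rewrite patchE; case: ifPn => [|/negP].
  by rewrite inE/= in_itv/= => ->; rewrite mulr1.
by rewrite inE/= in_itv/= => /negP/negbTE ->; rewrite mulr0.
Qed.

Lemma powR_half_le2 b : -1 <= b -> (2^-1 : R) `^ b <= 2.
Proof.
move=> b1; rewrite [leRHS](_ : 2 = (2^-1 : R) `^ (-1)); last by rewrite powR_inv1 ?invrK.
by apply: ger_powR => //; lra.
Qed.

Lemma powR_ge1 b y : b <= 0 -> 0 < y <= 1 -> 1 <= y `^ b.
Proof. by move=> b0 y01; rewrite -(powRr0 y); exact: ger_powR. Qed.

Lemma ler_ppow b x y : b <= 0 -> 0 < x -> x <= y -> ppow b y <= x `^ b.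
Proof.
move=> b0 x0 xy; have y0 := lt_le_trans x0 xy; rewrite ppow_gt0E//.
rewrite -[b]opprK [x `^ _]powRN [y `^ _]powRN lef_pV2 ?posrE ?powR_gt0//.
by rewrite ge0_ler_powR// ?nnegrE ?oppr_ge0// ltW.
Qed.

Lemma beta_cst_lty a : 0 < a -> a < 1 -> (beta_cst a < +oo)%E.
Proof.
move=> a0 a1.
pose F1 y : R := ppow ((1 - a) - 1) y * (y < 1)%R%:R.
pose F2 y : R := ppow (a - 1) y * (y < 1)%R%:R.
have mF g : measurable_fun setT (fun y => ppow (g - 1) y * (y < 1)%R%:R : R).
  apply: measurable_funM; first exact: measurable_ppow.
  rewrite (_ : (fun _ => _) = (fun y => if y < 1 then 1 else 0)); last first.
    by apply/funext => y; case: ifP.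
  by apply: measurable_fun_ifT => //; exact: measurable_fun_ltr.
have F0 g y : 0 <= ppow (g - 1) y * (y < 1)%R%:R by rewrite mulr_ge0// ppow_ge0.
have mF2 : measurable_fun setT (fun y => F2 (-1 * y + 1)).
  by apply: measurableT_comp; [exact: mF|exact: measurable_affine].
(* Up to [1 / 2] the factor singular at 1 is at most 2, beyond [1 / 2] the factor singular at 0 is;
   what remains has one integrable singularity. *)
apply: (@le_lt_trans _ _ (\int[mu]_y (2%:E * (F1 y)%:E + 2%:E * (F2 (-1 * y + 1))%:E))%E).
  apply: ge0_le_integral => //.
  - by move=> y _; rewrite lee_fin mulr_ge0// ppow_ge0.
  - by have := measurable_beta a 0 1; under eq_fun do rewrite subr0.
  - apply/measurable_EFinP; apply: measurable_funD; apply: measurable_funM => //.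
    exact: mF.
  - move=> y _; rewrite -!EFinM -EFinD lee_fin /F1 /F2 mulN1r [- y + 1]addrC.
    have [y0|y0] := leP y 0.
      by rewrite ppow_le0E// mul0r addr_ge0// mulr_ge0// mulr_ge0// ppow_ge0.
    have [y1|y1] := leP 1 y.
      by rewrite (@ppow_le0E _ _ (1 - y)) ?subr_le0// mulr0 !(mulr0,mul0r) addr0.
    rewrite !mulr1 (_ : 1 - y < 1) ?mulr1; last by lra.
    rewrite (_ : 1 - a - 1 = - a); last by ring.
    have [y2|y2] := leP y 2^-1.
      rewrite (@le_trans _ _ (ppow (- a) y * 2))//; last first.
        by rewrite mulrC lerDl mulr_ge0// ppow_ge0.
      rewrite ler_wpM2l ?ppow_ge0//.
      by rewrite (le_trans _ (@powR_half_le2 (a - 1) _))// ?ler_ppow//; lra.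
    rewrite (@le_trans _ _ (2 * ppow (a - 1) (1 - y)))//; last first.
      by rewrite lerDr mulr_ge0// ppow_ge0.
    rewrite ler_wpM2r ?ppow_ge0//.
    by rewrite (le_trans _ (@powR_half_le2 (- a) _))// ?ler_ppow//; lra.
have ge0_F1 y : (0 <= (F1 y)%:E)%E by rewrite lee_fin F0.
have ge0_F2 y : (0 <= (F2 y)%:E)%E by rewrite lee_fin F0.
have mF1E : measurable_fun setT (EFin \o F1) by apply/measurable_EFinP; exact: mF.
have mF2E : measurable_fun setT (fun y => (F2 (-1 * y + 1))%:E) by exact/measurable_EFinP.
rewrite ge0_integralTD ?ge0_integralTZl//; first last.
- by move=> y; rewrite mule_ge0.
- by move=> y; rewrite mule_ge0.
- exact: measurable_funeM.
- exact: measurable_funeM.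
rewrite integral_ppow_trunc ?subr_gt0//.
rewrite -(integral_isometry (f := fun y => (F2 y)%:E)) ?normrN1//; last first.
  by apply/measurable_EFinP; exact: mF.
by rewrite integral_ppow_trunc// -!EFinM -EFinD ltry.
Qed.

Lemma beta_cst_gt0 a : 0 < a -> a < 1 -> (0 < beta_cst a)%E.
Proof.
move=> a0 a1; apply: (@lt_le_trans _ _ (mu `]0, 1[%classic)).
  by rewrite lebesgue_measure_itv/= lte_fin ltr01 oppr0 adde0.
rewrite -[mu _]mul1e -integral_cst// integral_mkcond.
apply: ge0_le_integral => //.
- by move=> y _; rewrite patchE; case: ifPn.
- by apply/(measurable_restrictT _ _).1.
- by have := measurable_beta a 0 1; under eq_fun do rewrite subr0.
- move=> y _; rewrite patchE; case: ifPn; last first.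
    by move=> _; rewrite lee_fin mulr_ge0// ppow_ge0.
  rewrite inE/= in_itv/= => /andP[y0 y1]; rewrite lee_fin.
  rewrite !ppow_gt0E ?subr_gt0// -[leLHS]mulr1 ler_pM//; apply: powR_ge1; lra.
Qed.

End beta.

(** * Positivity of the Gamma function *)

Section gamma.
Context {R : realType}.
Notation mu := (@lebesgue_measure R).
Implicit Types a t : R.

Let gamma_fun a t : R := t `^ (1 - a - 1) * expR (- t).

Let gamma_fun_ge0 a t : 0 <= gamma_fun a t.
Proof. by rewrite mulr_ge0 ?powR_ge0 ?expR_ge0. Qed.

Let measurable_gamma_fun a : measurable_fun setT (EFin \o gamma_fun a).
Proof.
apply/measurable_EFinP; apply: measurable_funM; first exact: measurable_powR.
exact: measurableT_comp.
Qed.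

Let gamma_lty a : 0 < a -> a < 1 ->
  (\int[mu]_(t in `]0%R, +oo[) (gamma_fun a t)%:E < +oo)%E.
Proof.
move=> a0 a1.
(* Below 1 the exponential is dropped and [a < 1] gives integrability; from 1 on the power is at
   most 1 and [t ^ 2 / 2 <= expR t] gives the majorant [2 / t ^ 2]. *)
pose F1 t : R := ppow ((1 - a) - 1) t * (t < 1)%R%:R.
pose F2 : R -> \bar R := (fun t : R => (t `^ (- 1 - 1))%:E) \_ `[1, +oo[.
have mF1 : measurable_fun setT (EFin \o F1).
  apply/measurable_EFinP; apply: measurable_funM; first exact: measurable_ppow.
  rewrite (_ : (fun _ => _) = (fun y => if y < 1 then 1 else 0)); last first.
    by apply/funext => y; case: ifP.
  by apply: measurable_fun_ifT => //; exact: measurable_fun_ltr.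
have F10 t : (0 <= (F1 t)%:E)%E by rewrite lee_fin mulr_ge0// ppow_ge0.
have mF2 : measurable_fun setT F2.
  apply/(measurable_restrictT _ _).1 => //; apply: measurable_funTS.
  by apply/measurable_EFinP; exact: measurable_powR.
have F20 t : (0 <= F2 t)%E.
  by rewrite /F2 patchE; case: ifPn => // _; rewrite lee_fin powR_ge0.
apply: (@le_lt_trans _ _ (\int[mu]_t ((F1 t)%:E + 2%:E * F2 t))%E).
  rewrite integral_mkcond; apply: ge0_le_integralT.
  - apply/(measurable_restrictT _ _).1 => //; apply: measurable_funTS.
    exact: measurable_gamma_fun.
  - by apply: emeasurable_funD => //; exact: measurable_funeM.
  - by move=> t; rewrite patchE; case: ifPn => // _; rewrite lee_fin gamma_fun_ge0.
  move=> t; rewrite patchE; case: ifPn => [|_]; last first.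
    by rewrite adde_ge0 ?mule_ge0.
  rewrite inE/= in_itv/= andbT => t0; rewrite /F1 /F2 patchE ppow_gt0E//.
  have [t1|t1] := ltP t 1.
    rewrite memNset/=; last by rewrite in_itv/= andbT leNgt t1.
    rewrite mule0 adde0 mulr1 lee_fin /gamma_fun ler_piMr ?powR_ge0//.
    by rewrite expR_le1; lra.
  rewrite mem_set/=; last by rewrite in_itv/= andbT.
  rewrite mulr0 add0e -EFinM lee_fin /gamma_fun -[leRHS]mul1r.
  rewrite ler_pM ?powR_ge0 ?expR_ge0//.
    by rewrite -(powRr0 t) ler_powR//; lra.
  rewrite (_ : -1 - 1 = - 2%:R :> R); last by ring.
  rewrite powR_invn ?(ltW t0)// expRN -[2 in leRHS]invrK -invfM.
  rewrite lef_pV2 ?posrE ?expR_gt0 ?mulr_gt0 ?invr_gt0 ?exprn_gt0//.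
  by have := expR_ge1Dxn 1 (ltW t0); rewrite (_ : 2`! = 2%N)//; lra.
rewrite ge0_integralTD//.
- rewrite ge0_integralTZl// integral_ppow_trunc ?subr_gt0// -integral_mkcond.
  by rewrite integral_powR_ge// -EFinM -EFinD ltry.
- exact: measurable_funeM.
- by move=> t; rewrite mule_ge0.
Qed.

(** [Gamma] is a [Rintegral], which would be 0 if the integral were infinite; positivity therefore
    requires finiteness besides the lower bound [expR (- 1)] on []0, 1[]. *)
Lemma Gamma_gt0 a : 0 < a -> a < 1 -> 0 < Gamma (1 - a).
Proof.
move=> a0 a1; rewrite /Gamma /Rintegral fine_gt0//.
rewrite gamma_lty// andbT; apply: (@lt_le_trans _ _ ((expR (- 1))%:E * mu `]0%R, 1%R[%classic))%E.
  by rewrite lebesgue_measure_itv/= lte_fin ltr01 oppr0 adde0 mule1 lte_fin expR_gt0.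
rewrite -integral_cst//; apply: (@le_trans _ _ (\int[mu]_(t in `]0%R, 1%R[) (gamma_fun a t)%:E)%E).
  apply: ge0_le_integral => //.
  - by move=> t _; rewrite lee_fin expR_ge0.
  - by apply: measurable_funTS; exact: measurable_gamma_fun.
  - move=> t; rewrite /= in_itv/= => /andP[t0 t1]; rewrite lee_fin /gamma_fun.
    rewrite -[leLHS]mul1r ler_pM ?expR_ge0//; last by rewrite ler_expR; lra.
    by apply: powR_ge1; lra.
apply: ge0_subset_integral => //.
- by apply: measurable_funTS; exact: measurable_gamma_fun.
- by move=> t _; rewrite lee_fin gamma_fun_ge0.
- by move=> t /=; rewrite !in_itv/= => /andP[->].
Qed.

End gamma.

(** * Tonelli's theorem and measurability *)

Section tonelli_line.
Context {R : realType}.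
Notation mu := (@lebesgue_measure R).
Local Open Scope ereal_scope.

Lemma tonelli_line (f : R -> R -> \bar R) :
  measurable_fun setT (fun z : R * R => f z.1 z.2) -> (forall x y, 0 <= f x y) ->
  \int[mu]_x \int[mu]_y f x y = \int[mu]_y \int[mu]_x f x y.
Proof.
move=> mf f0.
exact: (@fubini_tonelli _ _ (measurableTypeR R) (measurableTypeR R) R mu mu
  (fun z => f z.1 z.2)).
Qed.

Lemma measurable_integral_line (f : R -> R -> \bar R) :
  measurable_fun setT (fun z : R * R => f z.1 z.2) -> (forall x y, 0 <= f x y) ->
  measurable_fun setT (fun x => \int[mu]_y f x y).
Proof.
move=> mf f0.
exact: (@measurable_fun_fubini_tonelli_F _ _ (measurableTypeR R) (measurableTypeR R) R
  mu (fun z => f z.1 z.2)).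
Qed.

Lemma measurable_natr_bool d (T : measurableType d) (b : T -> bool) :
  measurable_fun setT b -> measurable_fun setT (fun x => (b x)%:R : R).
Proof.
move=> mb; rewrite (_ : (fun _ => _) = (fun x => if b x then 1%R else 0%R)).
  exact: measurable_fun_ifT.
by apply/funext => x; case: (b x).
Qed.

Lemma integral_bool_Iio (f : R -> R) d :
  \int[mu]_t (f t * (t < d)%R%:R)%:E = \int[mu]_(t in `]-oo, d[) (f t)%:E.
Proof.
rewrite [RHS]integral_mkcond; apply: eq_integral => t _; rewrite patchE.
have [td|dt] := ltP t d; first by rewrite mulr1 mem_set//= in_itv.
by rewrite mulr0 memNset//= in_itv/= ltNge dt.
Qed.

Lemma integral_bool_Ici (f : R -> R) s :
  \int[mu]_t (f t * (s <= t)%R%:R)%:E = \int[mu]_(t in `[s, +oo[) (f t)%:E.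
Proof.
rewrite [RHS]integral_mkcond; apply: eq_integral => t _; rewrite patchE.
have [st|ts] := leP s t; first by rewrite mulr1 mem_set//= in_itv/= andbT.
by rewrite mulr0 memNset//= in_itv/= andbT leNgt ts.
Qed.

End tonelli_line.

(* Follows the syntax of the integrand; functions of the development that occur
   in it must have their measurability among the hypotheses. *)
Ltac measurability :=
  lazymatch goal with
  | |- measurable_fun _ (fun z => EFin (@?f z)) =>
      apply/measurable_EFinP; measurability
  | |- measurable_fun _ (fun z => GRing.mul (@?f z) (@?g z)) =>
      apply: (@measurable_realfun.measurable_funM _ _ _ _ f g); measurability
  | |- measurable_fun _ (fun z => (@?f z - @?g z)) =>
      apply: (@measurable_realfun.measurable_funB _ _ _ _ f g); measurability
  | |- measurable_fun _ (fun z => (@?f z + @?g z)) =>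
      apply: (@measurable_realfun.measurable_funD _ _ _ _ f g); measurability
  | |- measurable_fun _ (fun z => (nat_of_bool (@?f z))%:R) =>
      apply: (@measurable_natr_bool _ _ _ f); measurability
  | |- measurable_fun _ (fun z => ((@?f z) < (@?g z))%R) =>
      apply: (@measurable_fun_ltr _ _ _ _ f g); measurability
  | |- measurable_fun _ (fun z => ((@?f z) <= (@?g z))%R) =>
      apply: (@measurable_fun_ler _ _ _ _ f g); measurability
  | |- measurable_fun _ (fun z => ((@?f z) < (@?g z))%E) =>
      apply: (@measurable_fun_lte _ _ _ _ f g); measurability
  | |- measurable_fun _ (fun z => ppow ?b (@?f z)) =>
      apply: (@measurable_ppow_comp _ _ _ b f); measurability
  | |- measurable_fun _ (fun z => powR (@?f z) ?b) =>
      apply: (@measurableT_comp _ _ _ _ _ _ (@powR _ ^~ b) _ f);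
      [exact: measurable_powR|measurability]
  | |- measurable_fun _ (fun z => `|@?f z|) =>
      apply: (measurableT_comp (@normr_measurable _ setT)); measurability
  | |- measurable_fun _ fst => exact: measurable_fst
  | |- measurable_fun _ snd => exact: measurable_snd
  | |- measurable_fun _ (fun z => fst z) => exact: measurable_fst
  | |- measurable_fun _ (fun z => snd z) => exact: measurable_snd
  | |- measurable_fun _ (fun z => z) => exact: measurable_id
  | |- measurable_fun _ (fun _ => ?c) => exact: measurable_cst
  | |- measurable_fun _ (fun z => ?h (@?f z)) =>
      match goal with
      | |- measurable_fun _ ?g => is_var g; assumption
      | H : measurable_fun _ h |- _ =>
        lazymatch f with
        | (fun z => z) => exact: H
        | _ => apply: (measurableT_comp H); measurability
        end
      end
  | |- measurable_fun _ ?h => assumption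
  end.

(** * The maximal function on L^p *)

Section maximal.
Context {R : realType}.
Notation mu := (@lebesgue_measure R).
Variable f : R -> R.
Hypothesis f_ge0 : forall x, 0 <= f x.
Hypothesis locf : locally_integrable setT f.

Let mf : measurable_fun setT f. Proof. by case: locf. Qed.

Let cut (c x : R) : R := f x * (c < f x)%R%:R.

Let cut_ge0 c x : 0 <= cut c x. Proof. by rewrite mulr_ge0. Qed.

Let measurable_cut c : measurable_fun setT (cut c).
Proof.
by apply: measurable_funM => //; apply: measurable_natr_bool; exact: measurable_fun_ltr.
Qed.

Let loc_cut c : locally_integrable setT (cut c).
Proof.
case: locf => _ _ lf; split => //; first exact: openT.
move=> K _ cK; apply: le_lt_trans (lf K (@subsetT _ _) cK).
apply: ge0_le_integral => //=.
- exact: compact_measurable.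
- apply/measurable_EFinP/measurable_funTS; apply: measurableT_comp => //.
  exact: measurable_cut.
- by apply/measurable_EFinP/measurable_funTS; exact: measurableT_comp.
- move=> x _; rewrite lee_fin !ger0_norm// /cut ler_piMr//.
  by case: (c < f x).
Qed.

(* [f <= cut c + c], so that the weak (1, 1) inequality may be applied to the
   part of [f] above the level only, as in Marcinkiewicz interpolation. *)
Lemma HL_maximal_cut c x : 0 < c -> (HL_maximal f x <= HL_maximal (cut c) x + c%:E)%E.
Proof.
move=> c0; apply: ge_ereal_sup => _ [r rI <-].
have r0 : 0 < r by move: rI; rewrite /= in_itv/= andbT.
apply: (@le_trans _ _ (iavg (cut c) (ball x r) + c%:E)%E); last first.
  rewrite leeD2r//; apply: ereal_sup_ubound => /=.
  by exists r => //=; rewrite in_itv/= andbT.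
have mb : measurable (ball x r : set R) by exact: measurable_ball.
have mub : mu (ball x r) = (r *+ 2)%:E by rewrite lebesgue_measure_ball// ltW.
apply: (@le_trans _ _ (iavg (cut c \+ cst c) (ball x r))).
  rewrite /iavg lee_pmul2l//; last 2 first.
    by rewrite mub inver gt_eqF ?mulrn_wgt0.
    by rewrite mub inver gt_eqF ?mulrn_wgt0// lte_fin invr_gt0 mulrn_wgt0.
  apply: ge0_le_integral => //=.
  - apply/measurable_EFinP/measurable_funTS; exact: measurableT_comp.
  - apply/measurable_EFinP/measurable_funTS; apply: measurableT_comp => //.
    by apply: measurable_funD => //; exact: measurable_cut.
  - move=> y _; rewrite lee_fin !ger0_norm ?addr_ge0 ?(ltW c0)// /cut.
    by have [cf|fc] := ltP c (f y); rewrite ?mulr1 ?mulr0 ?add0r// lerDl ltW.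
apply: le_trans (iavgD mb _ _ _) _ => //.
- by rewrite mub ltry.
- by apply: measurable_funTS; exact: measurable_cut.
rewrite leeD2l// /iavg.
rewrite (@integral_cst _ _ _ mu _ mb `|c%:E|%E) mub inver gt_eqF ?mulrn_wgt0//.
rewrite gee0_abs ?lee_fin ?(ltW c0)// [X in (_ * (_ * X))%E]mub -!EFinM lee_fin.
by rewrite mulrCA mulVf ?mulr1// gt_eqF// mulrn_wgt0.
Qed.

(** The weak inequality for [cut (l / 2)] at level [l / 2]: its constant 3 becomes [3 / (l / 2)].
    Restricting the integral to [l < 2 * f x] is what makes the later integration over [l]
    converge. *)
Lemma maximal_inequality_cut l : 0 < l ->
  (mu [set x | l%:E < HL_maximal f x] <=
   (6 / l)%:E * \int[mu]_x (f x * (l < 2 * f x)%R%:R)%:E)%E.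
Proof.
move=> l0; have l20 : 0 < l / 2 by rewrite divr_gt0.
have -> : 6 / l = 3 / (l / 2) by rewrite invfM invrK; lra.
apply: (@le_trans _ _ (mu [set x | (l / 2)%:E < HL_maximal (cut (l / 2)) x]%E)).
  apply: le_measure; rewrite ?inE.
  - rewrite -[X in measurable X]setTI; apply: emeasurable_fun_o_infty => //.
    exact: measurable_HL_maximal.
  - rewrite -[X in measurable X]setTI; apply: emeasurable_fun_o_infty => //.
    exact: measurable_HL_maximal.
  - move=> x /= lx; have := lt_le_trans lx (HL_maximal_cut x l20).
    by rewrite {1}(splitr l) EFinD lteD2rE.
apply: le_trans (maximal_inequality (loc_cut _) l20) _.
rewrite lee_pmul2l//; last by rewrite lte_fin divr_gt0.
rewrite le_eqVlt; apply/orP; left; apply/eqP; apply: eq_integral => x _.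
rewrite gee0_abs ?lee_fin ?cut_ge0// /cut; congr (_ * _%:R)%:E.
by rewrite ltr_pdivrMr// mulrC.
Qed.

Lemma poweR_layer_cake (p : R) (m : \bar R) : 0 < p -> (0 <= m)%E ->
  (m `^ p = \int[mu]_l (p * ppow (p - 1) l * (l%:E < m)%E%:R)%:E)%E.
Proof.
move=> p0.
have real r : 0 <= r ->
    ((r `^ p)%R%:E = \int[mu]_l (p * ppow (p - 1) l * (l < r)%R%:R)%:E)%E.
  move=> r0; rewrite integral_bool_Iio.
  under eq_integral do rewrite EFinM.
  rewrite ge0_integralZl//; last 3 first.
  - by apply/measurable_EFinP/measurable_funTS; exact: measurable_ppow.
  - by move=> l _; rewrite lee_fin ppow_ge0.
  - by rewrite lee_fin ltW.
  rewrite integral_ppow_lt// -EFinM mulrA mulfV ?gt_eqF// mul1r; congr EFin.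
  have [->|rn0] := eqVneq r 0; first by rewrite powR0 ?gt_eqF// ppow_le0E.
  by rewrite ppow_gt0E// lt_neqAle eq_sym rn0.
case: m => [r|_|//]; first by rewrite lee_fin => r0; rewrite poweR_EFin real.
rewrite poweRyr ?gt_eqF//; apply/esym/eqyP => A A0.
rewrite -[A]powRr1 ?(ltW A0)// -[X in _ `^ X](@mulVf _ p) ?gt_eqF// powRrM.
rewrite real ?powR_ge0//; apply: ge0_le_integralT.
- apply/measurable_EFinP; apply: measurable_funM.
    by apply: measurable_funM => //; exact: measurable_ppow.
  by apply: measurable_natr_bool; exact: measurable_fun_ltr.
- apply/measurable_EFinP; apply: measurable_funM.
    by apply: measurable_funM => //; exact: measurable_ppow.
  by apply: measurable_natr_bool; exact: measurable_fun_lte.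
- by move=> l; rewrite lee_fin !mulr_ge0 ?ppow_ge0// ltW.
- move=> l; rewrite lee_fin ltry mulr1 ler_piMr ?mulr_ge0 ?ppow_ge0 ?(ltW p0)//.
  by case: (_ < _).
Qed.

(** By the layer-cake formula and [maximal_inequality_cut], the left side is at most the double
    integral of [6 * p * l ^ (p - 2) * f x] over [0 < l < 2 * f x]. Integrating in [l] first, which
    converges because [1 < p], gives [(2 * f x) ^ (p - 1) / (p - 1)] and hence the constant. *)
Lemma maximal_Lp (p : R) : 1 < p ->
  (\int[mu]_x (HL_maximal f x `^ p) <=
   (6 * p * (p - 1)^-1 * 2 `^ (p - 1))%:E * \int[mu]_x (f x `^ p)%R%:E)%E.
Proof.
move=> p1; have p0 : 0 < p by lra.
under eq_integral do rewrite (poweR_layer_cake p0 (HL_maximalT_ge0 locf _)).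
have mM := measurable_HL_maximal locf.
have m1 : measurable_fun setT
    (fun z : R * R => (p * ppow (p - 1) z.2 * (z.2%:E < HL_maximal f z.1)%E%:R)%:E).
  measurability.
have m2 : measurable_fun setT
    (fun z : R * R => (6 * p * ppow (p - 2) z.2 * (f z.1 * (z.2 < 2 * f z.1)%R%:R))%:E).
  by measurability.
rewrite tonelli_line//; last first.
  by move=> x l; rewrite lee_fin !mulr_ge0 ?ppow_ge0// ltW.
apply: (@le_trans _ _ (\int[mu]_l \int[mu]_x
    (6 * p * ppow (p - 2) l * (f x * (l < 2 * f x)%R%:R))%:E)%E).
  apply: ge0_le_integralT.
  - apply: (measurable_integral_line
      (f := fun l x => (p * ppow (p - 1) l * (l%:E < HL_maximal f x)%E%:R)%:E)).
      by measurability.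
    by move=> l x; rewrite lee_fin !mulr_ge0 ?ppow_ge0// ltW.
  - apply: (measurable_integral_line
      (f := fun l x => (6 * p * ppow (p - 2) l * (f x * (l < 2 * f x)%R%:R))%:E)).
      by measurability.
    by move=> l x; rewrite lee_fin !mulr_ge0 ?ppow_ge0// ltW.
  - by move=> l; apply: integral_ge0 => x _; rewrite lee_fin !mulr_ge0 ?ppow_ge0// ltW.
  - move=> l; have [l0|l0] := leP l 0.
      rewrite integral0_eq; last by move=> x _; rewrite ppow_le0E// mulr0 mul0r.
      by apply: integral_ge0 => x _; rewrite lee_fin !mulr_ge0 ?ppow_ge0// ltW.
    have sup_lE : (\int[mu]_x ((l%:E < HL_maximal f x)%E%:R)%:E =
        mu [set x | l%:E < HL_maximal f x])%E.
      rewrite -[X in mu X]setIT -integral_indic//.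
        by apply: eq_integral => x _; rewrite indicE mem_setE.
      by rewrite -[X in measurable X]setTI; exact: emeasurable_fun_o_infty.
    under eq_integral do rewrite EFinM.
    under [leRHS]eq_integral do rewrite EFinM.
    have ge0 k b : 0 <= k -> 0 <= k * ppow b l by move=> k0; rewrite mulr_ge0// ppow_ge0.
    rewrite ge0_integralTZl ?ge0 ?(ltW p0)//; last by measurability.
    rewrite ge0_integralTZl ?ge0 ?mulr_ge0 ?(ltW p0)//; last 2 first.
    - by measurability.
    - by move=> x; rewrite lee_fin mulr_ge0.
    rewrite sup_lE; apply: le_trans (lee_wpmul2l _ (maximal_inequality_cut l0)) _.
      by rewrite lee_fin ge0// ltW.
    rewrite muleA -EFinM (_ : _ * _ * (6 / l) = 6 * p * ppow (p - 2) l)//.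
    rewrite (_ : p - 2 = p - 1 - 1); last by ring.
    rewrite !ppow_gt0E// -[l `^ (p - 1)]mulr_powRB1 ?subr_gt0 ?(ltW l0)//.
    by field; rewrite gt_eqF.
rewrite -tonelli_line//; last first.
  by move=> x l; rewrite lee_fin !mulr_ge0 ?ppow_ge0// ltW.
rewrite -ge0_integralTZl; last first.
- by move=> x; rewrite lee_fin powR_ge0.
- by measurability.
- by rewrite !mulr_ge0 ?powR_ge0// ?invr_ge0; lra.
rewrite le_eqVlt; apply/orP; left; apply/eqP; apply: eq_integral => x _.
transitivity (\int[mu]_l ((6 * p * f x)%:E * (ppow ((p - 1) - 1) l * (l < 2 * f x)%R%:R)%:E))%E.
  apply: eq_integral => l _; rewrite -EFinM; congr EFin.
  rewrite (_ : p - 2 = p - 1 - 1); last by ring.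
  by rewrite -!mulrA [f x * (_ * _)]mulrCA.
have fx := f_ge0 x.
rewrite ge0_integralTZl.
- rewrite integral_bool_Iio integral_ppow_lt ?subr_gt0// -!EFinM; congr EFin.
  rewrite ppowM// -[f x `^ p]mulr_powRB1 //.
  have [fx0|fx0] := eqVneq (f x) 0; first by rewrite fx0 !(mulr0, mul0r).
  by rewrite ppow_gt0E ?lt_neqAle ?[0 == _]eq_sym ?fx0//; ring.
- by rewrite !mulr_ge0// ltW.
- by measurability.
- by move=> l; rewrite lee_fin mulr_ge0 ?ppow_ge0.
Qed.

End maximal.

(** * The Hardy-Littlewood-Sobolev inequality *)

Lemma gt0_mulr_powRB1 (R : realType) (b x : R) : 0 < x -> x * x `^ (b - 1) = x `^ b.
Proof.
move=> x0; rewrite -{1}[x]powRr1 ?(ltW x0)// -powRD; last first.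
  by apply/implyP => _; rewrite gt_eqF.
by congr (_ `^ _); ring.
Qed.

Lemma le_poweR (R : realType) (r : R) (x y : \bar R) :
  0 <= r -> (0 <= x)%E -> (x <= y)%E -> (x `^ r <= y `^ r)%E.
Proof.
move=> r0 x0 xy; apply: gt0_ler_poweR => //; rewrite in_itv/= leey andbT//.
exact: le_trans xy.
Qed.

(** * The Riesz potential and Hedberg's argument *)

Section riesz_potential.
Context {R : realType}.
Notation mu := (@lebesgue_measure R).
Variables (a p : R) (f : R -> R).
Hypotheses (a0 : (0 : R) < a) (a1 : a < (1 : R)) (p1 : (1 : R) < p) (ap : a * p < (1 : R)).
Hypothesis f_ge0 : forall x, 0 <= f x.
Hypothesis mf : measurable_fun setT f.

Let p0 : 0 < p. Proof. exact: lt_trans p1. Qed.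

Let g0 : 0 < p^-1 - a.
Proof. by rewrite subr_gt0 -div1r ltr_pdivlMr. Qed.

(** The one-sided potential, without its usual factor [1 / Gamma(a)]; the value may be infinite on a
    null set, hence the extended reals. *)
Definition riesz (x : R) : \bar R := (\int[mu]_y (ppow (a - 1) (x - y) * f y)%:E)%E.

Lemma riesz_ge0 x : (0 <= riesz x)%E.
Proof. by apply: integral_ge0 => y _; rewrite lee_fin mulr_ge0// ppow_ge0. Qed.

Lemma measurable_riesz : measurable_fun setT riesz.
Proof.
apply: (measurable_integral_line (f := fun x y => (ppow (a - 1) (x - y) * f y)%:E)).
  by measurability.
by move=> x y; rewrite lee_fin mulr_ge0// ppow_ge0.
Qed.

(** The indicator of [[x - s, x[], written with Booleans so that its joint measurability follows
    from the syntax. *)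
Let window (x s y : R) : R := (0 < x - y)%R%:R * (x - y <= s)%R%:R.
Let mass (x s : R) : \bar R := (\int[mu]_y (window x s y * f y)%:E)%E.

Let window_ge0 x s y : 0 <= window x s y.
Proof. by rewrite mulr_ge0. Qed.

Let mass_ge0 x s : (0 <= mass x s)%E.
Proof. by apply: integral_ge0 => y _; rewrite lee_fin mulr_ge0. Qed.

Let measurable_mass x : measurable_fun setT (mass x).
Proof.
apply: (measurable_integral_line (f := fun s y => (window x s y * f y)%:E)).
  by rewrite /window; measurability.
by move=> s y; rewrite lee_fin mulr_ge0.
Qed.

Let ppow_layer t : 0 < t ->
  ((ppow (a - 1) t)%:E =
   (1 - a)%:E * \int[mu]_s (ppow (a - 2) s * (t <= s)%R%:R)%:E)%E.
Proof.
move=> t0; rewrite integral_bool_Ici.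
have -> : (\int[mu]_(s in `[t, +oo[) (ppow (a - 2) s)%:E =
    \int[mu]_(s in `[t, +oo[) (s `^ (- (1 - a) - 1))%:E)%E.
  apply: eq_integral => s; rewrite inE/= in_itv/= andbT => ts.
  by rewrite ppow_gt0E ?(lt_le_trans t0)//; congr (_ `^ _)%:E; ring.
rewrite integral_powR_ge ?subr_gt0// -EFinM ppow_gt0E// mulrC divfK; last first.
  by rewrite gt_eqF// subr_gt0.
by congr (_ `^ _)%:E; ring.
Qed.

(** [ppow_layer] writes the kernel at distance [t] as an integral over the scales [s >= t];
    exchanging the integrals leaves only the masses of windows, so no dyadic sum is needed. *)
Let riesz_layer x :
  riesz x = ((1 - a)%:E * \int[mu]_s ((ppow (a - 2) s)%:E * mass x s))%E.
Proof.
have K0 : 0 <= 1 - a by rewrite subr_ge0 ltW.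
transitivity (\int[mu]_y ((1 - a)%:E *
    \int[mu]_s (ppow (a - 2) s * (window x s y * f y))%:E))%E.
  apply: eq_integral => y _; rewrite /window.
  have [xy|xy] := ltP 0 (x - y).
    rewrite EFinM ppow_layer// -muleA; congr (_ * _)%E.
    rewrite muleC -ge0_integralTZl//.
    - by apply: eq_integral => s _; rewrite -EFinM mul1r mulrC mulrA.
    - by measurability.
    - by move=> s; rewrite lee_fin mulr_ge0// ppow_ge0.
  rewrite ppow_le0E// mul0r [X in (_ * X)%E]integral0_eq ?mule0// => s _.
  by rewrite !mul0r mulr0.
rewrite ge0_integralTZl//; last 2 first.
- apply: (measurable_integral_line
    (f := fun y s => (ppow (a - 2) s * (window x s y * f y))%:E)).
    by rewrite /window; measurability.
  by move=> y s; rewrite lee_fin !mulr_ge0// ppow_ge0.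
- by move=> y; apply: integral_ge0 => s _; rewrite lee_fin !mulr_ge0// ppow_ge0.
congr (_ * _)%E; rewrite tonelli_line; last 2 first.
- by rewrite /window; measurability.
- by move=> y s; rewrite lee_fin !mulr_ge0// ppow_ge0.
apply: eq_integral => s _; rewrite -ge0_integralTZl ?ppow_ge0//.
- by rewrite /window; measurability.
- by move=> y; rewrite lee_fin mulr_ge0.
Qed.

(* The two bounds on the mass of [f] near [x] are used for [s < d] and [d <= s]. *)
Let riesz_le x (c1 c2 d : R) : 0 <= c1 -> 0 <= c2 -> 0 < d ->
  (forall s : R, 0 < s -> (mass x s <= (c1 * s)%:E)%E) ->
  (forall s : R, 0 < s -> (mass x s <= (c2 * s `^ (1 - p^-1))%:E)%E) ->
  (riesz x <= ((1 - a) * (c1 * (a^-1 * d `^ a) +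
                          c2 * (d `^ (- (p^-1 - a)) / (p^-1 - a))))%:E)%E.
Proof.
move=> c10 c20 d0 m1 m2; have K0 : 0 <= 1 - a by rewrite subr_ge0 ltW.
rewrite riesz_layer EFinM lee_wpmul2l//.
(* The mass bounds turn the weight [s ^ (a - 2)] into [s ^ (a - 1)], integrable at 0 as [0 < a], and
   into [s ^ (- (1 / p - a) - 1)], integrable at infinity as [a < 1 / p]. *)
pose G1 s : \bar R := (c1 * (ppow (a - 1) s * (s < d)%R%:R))%:E.
pose G2 s : \bar R := (c2 * (s `^ (- (p^-1 - a) - 1) * (d <= s)%R%:R))%:E.
have mG1 : measurable_fun setT G1 by rewrite /G1; measurability.
have mG2 : measurable_fun setT G2 by rewrite /G2; measurability.
have G10 s : (0 <= G1 s)%E by rewrite lee_fin !mulr_ge0// ppow_ge0.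
have G20 s : (0 <= G2 s)%E by rewrite lee_fin !mulr_ge0// powR_ge0.
apply: (@le_trans _ _ (\int[mu]_s (G1 s + G2 s))%E).
  apply: ge0_le_integralT.
  - by apply: emeasurable_funM => //; apply/measurable_EFinP; exact: measurable_ppow.
  - exact: emeasurable_funD.
  - by move=> s; rewrite mule_ge0 ?lee_fin ?ppow_ge0.
  move=> s; have [s0|s0] := leP s 0; first by rewrite ppow_le0E// mul0e adde_ge0.
  rewrite ppow_gt0E// /G1 /G2; have [sd|ds] := ltP s d.
    rewrite mulr1 !mulr0 adde0 (le_trans (lee_wpmul2l _ (m1 s s0)))//.
      by rewrite lee_fin powR_ge0.
    rewrite -EFinM lee_fin mulrCA ler_wpM2l// ppow_gt0E// mulrC.
    by rewrite (_ : a - 2 = (a - 1) - 1) ?gt0_mulr_powRB1//; ring.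
  rewrite !mulr0 add0e mulr1 (le_trans (lee_wpmul2l _ (m2 s s0)))//.
    by rewrite lee_fin powR_ge0.
  rewrite -EFinM lee_fin mulrCA ler_wpM2l// -powRD; last first.
    by apply/implyP => _; rewrite gt_eqF.
  by rewrite (_ : a - 2 + (1 - p^-1) = - (p^-1 - a) - 1)//; ring.
rewrite ge0_integralTD// /G1 /G2.
under eq_integral do rewrite EFinM.
rewrite ge0_integralTZl//; last 2 first.
- by measurability.
- by move=> s; rewrite lee_fin mulr_ge0// ppow_ge0.
rewrite integral_bool_Iio integral_ppow_lt// ppow_gt0E//.
under [X in (_ + X)%E]eq_integral do rewrite EFinM.
rewrite ge0_integralTZl//; last 2 first.
- by measurability.
- by move=> s; rewrite lee_fin mulr_ge0// powR_ge0.
by rewrite integral_bool_Ici integral_powR_ge.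
Qed.

(** The window contains the point [x - s], which the open ball of radius [s] misses. Doubling the
    radius yields a ball of measure [4 * s], the origin of the 4. *)
Let mass_le_HL x s m : 0 < s -> HL_maximal f x = m%:E -> (mass x s <= (4 * m * s)%:E)%E.
Proof.
move=> s0 xm; have s20 : 0 < 2 * s by rewrite mulr_gt0.
have mb : measurable (ball x (2 * s) : set R) by exact: measurable_ball.
have mub : mu (ball x (2 * s)) = (4 * s)%:E.
  by rewrite lebesgue_measure_ball ?ltW//; congr EFin; rewrite -mulr_natl; ring.
apply: (@le_trans _ _ (\int[mu]_(y in ball x (2 * s)) `|(f y)%:E|)%E).
  rewrite integral_mkcond; apply: ge0_le_integralT.
  - by rewrite /window; measurability.
  - apply/(measurable_restrictT _ _).1 => //; apply: measurable_funTS.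
    by apply: measurableT_comp => //; exact/measurable_EFinP.
  - by move=> y; rewrite lee_fin mulr_ge0.
  move=> y; rewrite patchE /window; case: ifPn => [_|/negP yb].
    rewrite abse_EFin lee_fin ger0_norm// ler_piMl//.
    by rewrite mulr_ile1// lern1 leq_b1.
  have [xy|_] := ltP 0 (x - y); last by rewrite !mul0r.
  have [xys|_] := leP (x - y) s; last by rewrite mulr0 mul0r.
  exfalso; apply: yb; rewrite inE /ball/= gtr0_norm//.
  by rewrite (le_lt_trans xys)// ltr_pMl// ltr1n.
have : (iavg f (ball x (2 * s)) <= HL_maximal f x)%E.
  by apply: ereal_sup_ubound => /=; exists (2 * s) => //=; rewrite in_itv/= andbT.
rewrite xm /iavg mub inver gt_eqF ?mulr_gt0// lee_pdivrMl ?mulr_gt0//.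
by rewrite -EFinM (_ : 4 * s * m = 4 * m * s)//; ring.
Qed.

Let mass_le_Lp x s B : 0 < s -> (\int[mu]_y (f y `^ p)%R%:E <= B%:E)%E ->
  (mass x s <= (B `^ p^-1 * s `^ (1 - p^-1))%:E)%E.
Proof.
move=> s0 fB.
have q0 : 0 < 1 - p^-1 by rewrite subr_gt0 invf_lt1.
have mw : measurable_fun setT (window x s) by rewrite /window; measurability.
(* Hölder's inequality; the norm of the window for the conjugate exponent is [s ^ (1 - 1 / p)]. *)
have := @hoelder _ _ _ mu f (window x s) p (1 - p^-1)^-1 mf mw p0.
rewrite invr_gt0 => /(_ q0); rewrite invrK addrC subrK => /(_ erefl).
have windowE y : window x s y = \1_(`[x - s, x[) y.
  rewrite indicE /window mem_setE in_itv/= subr_gt0 lerBlDl -lerBlDr andbC.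
  by case: (y < x); case: (_ <= y); rewrite ?(mul0r, mulr0, mulr1).
have normpf : (\int[mu]_y `|(f y)%:E| `^ p = \int[mu]_y (f y `^ p)%R%:E)%E.
  by apply: eq_integral => y _; rewrite gee0_abs ?lee_fin.
have q1 : (1 - p^-1)^-1 != 0 by rewrite invr_eq0 gt_eqF.
have normqw : (\int[mu]_y `|(window x s y)%:E| `^ (1 - p^-1)^-1 = s%:E)%E.
  transitivity (\int[mu]_y (\1_(`[x - s, x[) y)%:E)%E.
    apply: eq_integral => y _; rewrite windowE indicE.
    rewrite abse_EFin poweR_EFin; case: (_ \in _); first by rewrite normr1 powR1.
    by rewrite normr0 powR0.
  rewrite integral_indic// setIT [LHS](lebesgue_measure_itv `[x - s, x[)/= lte_fin ltrBlDr ltrDl s0.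
  by rewrite -EFinB; congr EFin; ring.
rewrite Lnorm1 unlock normpf normqw invrK.
under eq_integral do rewrite gee0_abs ?lee_fin ?mulr_ge0//.
rewrite [X in (X <= _)%E -> _](_ : _ = mass x s); last first.
  by apply: eq_integral => y _; rewrite mulrC.
move=> /le_trans; apply; rewrite EFinM poweR_EFin lee_wpmul2r ?lee_fin ?powR_ge0//.
rewrite -poweR_EFin le_poweR ?invr_ge0 ?(ltW p0)//.
by apply: integral_ge0 => y _; rewrite lee_fin powR_ge0.
Qed.

Let K : R := (1 - a) * (4 / a + (p^-1 - a)^-1).

Let K_gt0 : 0 < K.
Proof. by rewrite mulr_gt0 ?subr_gt0// addr_gt0 ?invr_gt0// divr_gt0. Qed.

Let KB_ge0 (B : R) : 0 <= K * B `^ a.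
Proof. by rewrite mulr_ge0 ?powR_ge0// ltW. Qed.

Let q : R := p / (1 - a * p).

Let q_gt0 : 0 < q. Proof. by rewrite divr_gt0 ?subr_gt0. Qed.

Let qE : (1 - a * p) * q = p.
Proof. by rewrite /q mulrC divfK// gt_eqF// subr_gt0. Qed.

Let riesz_le_HL_real x m B : 0 <= m -> 0 < B ->
  (\int[mu]_y (f y `^ p)%R%:E <= B%:E)%E -> HL_maximal f x = m%:E ->
  (riesz x <= (K * B `^ a * m `^ (1 - a * p))%:E)%E.
Proof.
move=> m0 B0 fB xm; have [m_eq0|m_neq0] := eqVneq m 0.
  rewrite m_eq0 powR0 ?mulr0; last by rewrite gt_eqF// subr_gt0.
  (* For [m = 0] the balancing radius below is not positive, but then every window has mass 0, and
     any radius will do. *)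
  have := @riesz_le x 0 0 1 (lexx _) (lexx _) ltr01; rewrite !mul0r addr0 mulr0; apply.
    by move=> s s0; have := mass_le_HL s0 xm; rewrite m_eq0 mulr0.
  by move=> s s0; have := mass_le_HL s0 xm; rewrite m_eq0 mulr0 !mul0r.
have {m_neq0}m0 : 0 < m by rewrite lt_neqAle eq_sym m_neq0.
(* this radius balances the two terms of [riesz_le] *)
have d0 : 0 < B * m `^ (- p) by rewrite mulr_gt0 ?powR_gt0.
have := @riesz_le x (4 * m) (B `^ p^-1) _ _ (powR_ge0 _ _) d0
  (fun s s0 => @mass_le_HL x s m s0 xm) (fun s s0 => @mass_le_Lp x s B s0 fB).
rewrite mulr_ge0 ?(ltW m0)// => /(_ erefl) /le_trans; apply.
rewrite lee_fin /K !powRM ?powR_ge0 ?(ltW B0)// -!powRrM.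
rewrite le_eqVlt; apply/orP; left; apply/eqP.
have E1 : m * m `^ (- p * a) = m `^ (1 - a * p).
  rewrite -(gt0_mulr_powRB1 (1 - a * p) m0); congr (_ * _ `^ _); ring.
have E2 : B `^ p^-1 * B `^ (- (p^-1 - a)) = B `^ a.
  by rewrite -powRD; [congr (_ `^ _); ring|apply/implyP => _; rewrite gt_eqF].
have E3 : m `^ (- p * - (p^-1 - a)) = m `^ (1 - a * p).
  by congr (_ `^ _); field; rewrite gt_eqF.
transitivity ((1 - a) * (4 / a * (B `^ a * (m * m `^ (- p * a))) +
    (B `^ p^-1 * B `^ (- (p^-1 - a))) * m `^ (1 - a * p) / (p^-1 - a))).
  by rewrite E3; ring.
by rewrite E1 E2; ring.
Qed.

(** By [qE], the power [q] of the pointwise bound contains exactly the power [p] of the maximal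
    function. Where that function is infinite the bound is trivial. *)
Lemma riesz_le_HL x B : 0 < B -> (\int[mu]_y (f y `^ p)%R%:E <= B%:E)%E ->
  locally_integrable setT f ->
  (riesz x `^ q <= ((K * B `^ a) `^ q)%:E * (HL_maximal f x) `^ p)%E.
Proof.
move=> B0 fB locf; have := HL_maximalT_ge0 locf x.
case xm : (HL_maximal f x) => [m| |] //; last first.
  move=> _.
  rewrite poweRyr ?gt_eqF// mulry gtr0_sg ?mul1e ?leey//.
  by rewrite powR_gt0// mulr_gt0// powR_gt0.
rewrite lee_fin => m0.
apply: le_trans (le_poweR (ltW q_gt0) (riesz_ge0 x) (riesz_le_HL_real m0 B0 fB xm)) _.
rewrite !poweR_EFin -EFinM lee_fin (powRM _ (KB_ge0 B) (powR_ge0 _ _)).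
by rewrite -powRrM qE.
Qed.

(** [t <= 1 + t ^ p], and compact sets have finite measure. *)
Lemma locally_integrable_Lp B : (\int[mu]_y (f y `^ p)%R%:E <= B%:E)%E ->
  locally_integrable setT f.
Proof.
move=> fB; split => //; first exact: openT.
move=> D _ cD.
have mD : measurable D by exact: compact_measurable.
have mNf : measurable_fun setT (fun y : R => `|f y|%:E) by measurability.
have mfp : measurable_fun setT (fun y : R => (f y `^ p)%:E) by measurability.
apply: (@le_lt_trans _ _ (\int[mu]_(y in D) (1 + (f y `^ p)%:E)))%E.
  apply: ge0_le_integral => //=.
  - exact: measurable_funTS.
  - by apply: measurable_funTS; exact: emeasurable_funD.
  - move=> y _; rewrite -EFinD lee_fin ger0_norm//.
    have [fy1|fy1] := leP (f y) 1; first by rewrite (le_trans fy1)// lerDl powR_ge0.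
    by rewrite -[leLHS]add0r lerD// le1r_powR ?(ltW fy1) ?(ltW p1).
rewrite ge0_integralD//.
- rewrite integral_cst// mul1e lte_add_pinfty ?compact_finite_measure//.
  apply: le_lt_trans (ltry B); apply: le_trans fB.
  apply: ge0_subset_integral => //.
  by move=> y _; rewrite lee_fin powR_ge0.
- by move=> y _; rewrite lee_fin powR_ge0.
- exact: measurable_funTS.
Qed.

Let Cp : R := 6 * p * (p - 1)^-1 * 2 `^ (p - 1).

Let Cp_gt0 : 0 < Cp.
Proof. by rewrite !mulr_gt0 ?powR_gt0 ?invr_gt0 ?subr_gt0. Qed.

Lemma riesz_Lnorm_le B : 0 < B -> (\int[mu]_y (f y `^ p)%R%:E <= B%:E)%E ->
  ('N[mu]_q%:E[riesz] <= (K * Cp `^ q^-1 * B `^ p^-1)%:E)%E.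
Proof.
move=> B0 fB; have locf := locally_integrable_Lp fB.
have : (\int[mu]_x (`|riesz x| `^ q) <= ((K * B `^ a) `^ q * Cp * B)%:E)%E.
  apply: (@le_trans _ _ (\int[mu]_x (((K * B `^ a) `^ q)%:E * (HL_maximal f x) `^ p))%E).
    apply: ge0_le_integralT.
    - apply: (measurableT_comp (measurable_poweR _)).
      by apply: measurableT_comp => //; exact: measurable_riesz.
    - apply: measurable_funeM; apply: (measurableT_comp (measurable_poweR _)).
      exact: measurable_HL_maximal.
    - by move=> x; rewrite poweR_ge0.
    - by move=> x; rewrite gee0_abs ?riesz_ge0//; exact: riesz_le_HL.
  rewrite ge0_integralTZl ?powR_ge0//; last 2 first.
  - apply: (measurableT_comp (measurable_poweR _)).
    exact: measurable_HL_maximal.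
  - by move=> x; rewrite poweR_ge0.
  rewrite -mulrA [leRHS]EFinM lee_wpmul2l ?lee_fin ?powR_ge0//.
  apply: le_trans (maximal_Lp f_ge0 locf p1) _.
  by rewrite [leRHS]EFinM lee_wpmul2l// lee_fin ltW.
move=> rB; rewrite unlock.
apply: le_trans (le_poweR _ _ rB) _.
- by rewrite invr_ge0 ltW.
- by apply: integral_ge0 => x _; rewrite poweR_ge0.
have CpB : 0 <= Cp * B by rewrite mulr_ge0 ?ltW.
rewrite poweR_EFin lee_fin -mulrA (powRM _ (powR_ge0 _ _) CpB).
rewrite -powRrM mulfV ?gt_eqF// powRr1 ?KB_ge0// (powRM _ (ltW Cp_gt0) (ltW B0)).
(* The Sobolev relation [1 / p = a + 1 / q]. *)
have -> : B `^ p^-1 = B `^ a * B `^ q^-1.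
  rewrite -powRD; last by apply/implyP => _; rewrite gt_eqF.
  by congr (_ `^ _); rewrite /q invf_div; field; rewrite gt_eqF.
rewrite le_eqVlt; apply/orP; left; apply/eqP; ring.
Qed.

End riesz_potential.

Section hardy_littlewood_sobolev.
Context {R : realType}.
Notation mu := (@lebesgue_measure R).
Local Open Scope ereal_scope.

Theorem hardy_littlewood_sobolev (a p : R) : (0 < a)%R -> (a < 1)%R -> (1 < p)%R ->
  (a * p < 1)%R ->
  exists2 C : R, (0 < C)%R & forall f : R -> R, measurable_fun setT f ->
    (forall x, (0 <= f x)%R) ->
    'N[mu]_((p / (1 - a * p))%:E)[riesz a f] <= C%:E * 'N[mu]_(p%:E)[EFin \o f].
Proof.
move=> a0 a1 p1 ap; have p0 : (0 < p)%R by exact: lt_trans p1.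
have [C C0 CP] : exists2 C : R, (0 < C)%R & forall f : R -> R, measurable_fun setT f ->
    (forall x, (0 <= f x)%R) -> forall B, (0 < B)%R ->
    \int[mu]_y (f y `^ p)%R%:E <= B%:E ->
    'N[mu]_((p / (1 - a * p))%:E)[riesz a f] <= (C * B `^ p^-1)%R%:E.
  (* The witness is read off from [riesz_Lnorm_le]; only its positivity remains. *)
  eexists; last by move=> f mf f0 B; exact: riesz_Lnorm_le.
  have g0 : (0 < p^-1 - a)%R by rewrite subr_gt0 -div1r ltr_pdivlMr.
  rewrite mulr_gt0// ?powR_gt0//.
    by rewrite mulr_gt0 ?subr_gt0// addr_gt0 ?invr_gt0// divr_gt0.
  by rewrite !mulr_gt0 ?powR_gt0 ?invr_gt0 ?subr_gt0.
exists C => // f mf f0; set Nr := 'N[mu]_ _ [_].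
have normpE : \int[mu]_y `|(f y)%:E| `^ p = \int[mu]_y (f y `^ p)%R%:E.
  by apply: eq_integral => y _; rewrite gee0_abs ?lee_fin.
have I0 : 0 <= \int[mu]_y (f y `^ p)%R%:E.
  by apply: integral_ge0 => y _; rewrite lee_fin powR_ge0.
have -> : 'N[mu]_(p%:E)[EFin \o f] = (\int[mu]_y (f y `^ p)%R%:E) `^ p^-1.
  by rewrite unlock normpE.
case IE : (\int[mu]_y _) I0 => [A| |] //; last first.
  by move=> _; rewrite poweRyr ?invr_eq0 ?gt_eqF// mulry gtr0_sg// mul1e leey.
rewrite lee_fin le_eqVlt => /predU1P[A0|A0]; last first.
  by rewrite poweR_EFin -EFinM CP// IE.
rewrite -A0 poweR_EFin powR0 ?invr_eq0 ?gt_eqF// mule0.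
(* The norm of [f] vanishes, but [CP] needs [0 < B]. Taking [B = (e / C) ^ p] bounds the norm of the
   potential by an arbitrary [e > 0]. *)
apply/lee_addgt0Pr => e e0; rewrite add0e.
have eC0 : (0 < e / C)%R by rewrite divr_gt0.
rewrite (_ : e = C * ((e / C) `^ p) `^ p^-1)%R.
  by apply: CP => //; rewrite ?powR_gt0// IE -A0 lee_fin powR_ge0.
by rewrite -powRrM mulfV ?gt_eqF// powRr1 ?(ltW eC0)// mulrC divfK ?gt_eqF.
Qed.

End hardy_littlewood_sobolev.

(** * Test functions *)

Section flat_power.
Context {R : realType}.
Implicit Types b d x y : R.

(* A smooth approximation of [y_+ `^ b] as [d] tends to 0. *)
Definition flat d b y : R := ppow b y * expR (- (d / y)).

Lemma flat_le0E d b y : y <= 0 -> flat d b y = 0.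
Proof. by move=> y0; rewrite /flat ppow_le0E// mul0r. Qed.

Lemma flat_ge0 d b y : 0 <= flat d b y.
Proof. by rewrite mulr_ge0 ?ppow_ge0 ?expR_ge0. Qed.

Lemma flat_le_ppow d b y : 0 < d -> flat d b y <= ppow b y.
Proof.
move=> d0; have [y0|y0] := leP y 0; first by rewrite flat_le0E// ppow_ge0.
by rewrite /flat ler_piMr ?ppow_ge0// expR_le1 oppr_le0 divr_ge0// ltW.
Qed.

(** A quadratic bound forces derivative 0 at the origin. It comes from [expR z >= z ^ n / n!] at
    [z = d / y], with [n] so large that [b + n >= 2]; for [y <= 1] the exponent may then be lowered
    to 2. *)
Lemma flat_le_sqr d b : 0 < d -> exists2 C, 0 < C &
  forall y, y <= 1 -> flat d b y <= C * y ^+ 2.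
Proof.
move=> d0; pose n := (Num.truncn (2 - b)).+1.
exists (n`!%:R / d ^+ n).
  by rewrite divr_gt0// ?exprn_gt0// ltr0n fact_gt0.
move=> y y1; have C0 : 0 <= n`!%:R / d ^+ n by rewrite divr_ge0// exprn_ge0// ltW.
have [y0|y0] := leP y 0; first by rewrite flat_le0E// mulr_ge0// sqr_ge0.
have dy0 : 0 < d / y by rewrite divr_gt0.
have bn : 2 <= b + n%:R by rewrite -lerBlDl ltW// truncnS_gt.
rewrite /flat ppow_gt0E// expRN.
apply: (@le_trans _ _ (y `^ b * (n`!%:R / d ^+ n * y ^+ n))).
  rewrite ler_wpM2l ?powR_ge0// -[leRHS]invrK lef_pV2 ?posrE ?expR_gt0 ?invr_gt0//; last first.
    by rewrite mulr_gt0 ?exprn_gt0// divr_gt0// ?exprn_gt0// ltr0n fact_gt0.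
  have := expR_ge1Dxn (Num.truncn (2 - b)) (ltW dy0); rewrite -/n => /(le_trans _); apply.
  by rewrite -[leLHS]add0r lerD// expr_div_n !invfM invrK -mulrA mulrC.
rewrite mulrCA ler_wpM2l// -!powR_mulrn ?(ltW y0)// -powRD; last first.
  by apply/implyP => _; rewrite gt_eqF.
by apply: ger_powR => //; rewrite y0.
Qed.

(** The derivative is a combination of [flat] functions with smaller exponents, also at the origin
    and for every real [b]; smoothness thus follows by induction. *)
Lemma is_derive_flat d b x : 0 < d ->
  is_derive x 1 (flat d b) (b * flat d (b - 1) x + d * flat d (b - 2) x).
Proof.
move=> d0; have [x0|x0|x0] := ltgtP x 0.
- rewrite !flat_le0E ?ltW// !mulr0 addr0.
  apply: (@near_eq_is_derive _ _ _ (cst 0)) => //.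
  near=> y; rewrite flat_le0E// ltW//; near: y; exact: lt_nbhsl.
- apply: (@near_eq_is_derive _ _ _ (fun y => y `^ b * expR (- (d / y)))) => //.
    near=> y; rewrite /flat ppow_gt0E//; near: y; exact: lt_nbhsr.
  have H1 := is_derive1_powR b x0.
  have xn0 : x != 0 by rewrite gt_eqF.
  have H2 : is_derive x 1 (fun y => - (d * y^-1)) (d / x ^+ 2).
    have H := @is_deriveV _ id x 1 1 xn0 (is_derive_id _ _).
    apply: is_derive_eq; rewrite /GRing.scale/=.
    by ring.
  have H3 : is_derive x 1 (fun y => expR (- (d / y))) (expR (- (d / x)) * (d / x ^+ 2)).
    exact: (@is_derive1_comp _ expR (fun y => - (d / y)) x).
  apply: is_derive_eq; rewrite /flat !ppow_gt0E// /GRing.scale/=.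
  have E : x `^ (b - 2) = x `^ b / x ^+ 2.
    rewrite powRB; last by apply/implyP.
    by rewrite powR_mulrn// ltW.
  by rewrite E; ring.
- rewrite x0 !flat_le0E// !mulr0 addr0.
  have [C C0 CP] := flat_le_sqr b d0.
  have cv : h^-1 *: (flat d b (h *: (1 : R) + 0) - flat d b 0) @[h --> (0 : R)^'] --> (0 : R).
    apply/cvgrPdist_le => e e0; near=> h.
    have h1 : `|h| <= 1 by near: h; apply: dnbhs0_le.
    have hC : `|h| <= e / C by near: h; apply: dnbhs0_le; rewrite divr_gt0.
    have hn0 : h != 0 by near: h; exact: nbhs_dnbhs_neq.
    rewrite sub0r normrN (flat_le0E _ _ (lexx 0)) subr0 addr0 /GRing.scale/= mulr1.
    rewrite normrM normfV ger0_norm ?flat_ge0// ler_pdivrMl ?normr_gt0//.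
    rewrite (le_trans (CP _ (le_trans (ler_norm _) h1)))//.
    rewrite -real_normK ?num_real// expr2 mulrA mulrC ler_wpM2l//.
    by rewrite mulrC -ler_pdivlMr.
  apply: DeriveDef.
    by apply/cvg_ex; exists 0.
  exact: cvg_lim cv.
Unshelve. all: by end_near. Qed.

End flat_power.

Section elementary.
Context {R : realType}.

(* A class of smooth functions that is closed under differentiation and holds
   the test functions below. *)
Inductive elementary : (R -> R) -> Prop :=
| elementary_flat d b s c : 0 < d -> elementary (fun x => flat d b (s * x + c))
| elementary_add f g : elementary f -> elementary g -> elementary (fun x => f x + g x)
| elementary_mul f g : elementary f -> elementary g -> elementary (fun x => f x * g x)
| elementary_scale k f : elementary f -> elementary (fun x => k * f x).

Lemma is_derive_flat_affine d b s c (x : R) : 0 < d ->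
  is_derive x 1 (fun x => flat d b (s * x + c))
    (s * (b * flat d (b - 1) (s * x + c) + d * flat d (b - 2) (s * x + c))).
Proof.
move=> d0; have H1 : is_derive x 1 (fun x => s * x + c) s.
  by apply: is_derive_eq; rewrite /GRing.scale/=; ring.
have H2 := is_derive_flat b (s * x + c) d0.
have H := @is_derive1_comp _ (flat d b) (fun x => s * x + c) x _ _ H2 H1.
by apply: is_derive_eq; rewrite mulrC.
Qed.

Lemma elementary_derive f : elementary f ->
  exists2 g, elementary g & forall x : R, is_derive x 1 f (g x).
Proof.
elim => [d b s c d0|{}f1 f2 _ [g1 e1 d1] _ [g2 e2 d2]
  |{}f1 f2 ef1 [g1 e1 d1] ef2 [g2 e2 d2]|k {}f ef [g e d]].
- exists (fun x => s * (b * flat d (b - 1) (s * x + c) + d * flat d (b - 2) (s * x + c))).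
    by apply: elementary_scale; apply: elementary_add; apply: elementary_scale;
      exact: elementary_flat.
  by move=> x; exact: is_derive_flat_affine.
- by exists (fun x => g1 x + g2 x) => [|x]; [exact: elementary_add|exact: is_deriveD].
- exists (fun x => f1 x * g2 x + f2 x * g1 x).
    by apply: elementary_add; exact: elementary_mul.
  by move=> x; exact: is_deriveM.
- by exists (fun x => k * g x) => [|x]; [exact: elementary_scale|exact: is_deriveZ].
Qed.

Lemma elementary_smooth f : elementary f ->
  forall n (x : R), derivable (derive1n n f) x 1.
Proof.
move=> ef n; elim: n f ef => [|n IH] f ef x.
  by by have [g _ /(_ x)[]] := elementary_derive ef.
have [g eg fg] := elementary_derive ef.
rewrite (_ : derive1n n.+1 f = derive1n n g); first exact: IH.
rewrite /derive1n iterSr; congr (iter n _ _); apply/funext => y.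
by rewrite derive1E; have [_ ->] := fg y.
Qed.

Lemma elementary_continuous f : elementary f -> continuous f.
Proof.
move=> ef x; apply: differentiable_continuous; apply/derivable1_diffP.
by have [g _ /(_ x)[]] := elementary_derive ef.
Qed.

Lemma compact_support_itv (f : R -> R) (c d : R) :
  (forall x, f x != 0 -> c <= x <= d) -> compact (closure [set x | f x != 0]).
Proof.
move=> fcd; apply: (subclosed_compact _ (@segment_compact _ c d)).
  exact: closed_closure.
apply: (subset_trans (closure_subset _ (B := `[c, d]%classic))); last first.
  by rewrite -(closure_id _).1//; exact: interval_closed.
by move=> x /= /fcd; rewrite in_itv.
Qed.

Lemma continuous_bounded_support (f : R -> R) (c d : R) : continuous f ->
  (forall x, f x != 0 -> c <= x <= d) -> exists2 M, 0 < M & forall x, `|f x| <= M.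
Proof.
move=> cf fcd.
have : bounded_set (f @` `[c, d]%classic).
  apply: compact_bounded; apply: continuous_compact; last exact: segment_compact.
  exact: continuous_subspaceT.
move=> [M [_ MP]]; exists (Num.max M 0 + 1); first by rewrite ltr_pwDr// le_max lexx orbT.
move=> x; have [fx0|fx0] := eqVneq (f x) 0.
  by rewrite fx0 normr0 addr_ge0// le_max lexx orbT.
apply: MP; first by rewrite ltr_pwDr// le_max lexx.
by exists x => //=; rewrite in_itv/=; exact: fcd.
Qed.

End elementary.

Lemma cvg_expR {R : realType} (u : nat -> R) (l : R) : u n @[n --> \oo] --> l ->
  expR (u n) @[n --> \oo] --> expR l.
Proof. by move=> ul; apply: (cvg_comp _ _ ul); exact: continuous_expR. Qed.

(** * Bounds and limits for the flattened powers *)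

Section flat_step.
Context {R : realType}.
Implicit Types (al a b d x y : R) (n : nat).

Definition dflat d b y : R := b * flat d (b - 1) y + d * flat d (b - 2) y.

Lemma dflat_le0E d b y : y <= 0 -> dflat d b y = 0.
Proof. by move=> y0; rewrite /dflat !flat_le0E// !mulr0 addr0. Qed.

Lemma dflat_ge0 d b y : 0 < d -> 0 <= b -> 0 <= dflat d b y.
Proof.
move=> d0 b0; apply: addr_ge0; apply: mulr_ge0 => //; rewrite ?flat_ge0//.
exact: ltW.
Qed.

Lemma mulr_expRN_le1 (z : R) : z * expR (- z) <= 1.
Proof.
rewrite expRN ler_pdivrMr ?expR_gt0// mul1r.
by rewrite (le_trans _ (expR_ge1Dx z))// lerDr.
Qed.

(** The term carrying [d] equals [y ^ (b - 1)] times [z * expR (- z)] with [z = d / y], and that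
    factor is at most 1. The bound is therefore uniform in [d]. *)
Lemma dflat_le d b y : 0 < d -> 0 <= b -> dflat d b y <= (b + 1) * ppow (b - 1) y.
Proof.
move=> d0 b0; have [y0|y0] := leP y 0.
  by rewrite dflat_le0E// mulr_ge0 ?addr_ge0// ppow_ge0.
rewrite /dflat mulrDl mul1r lerD//.
  by rewrite ler_wpM2l// flat_le_ppow.
rewrite /flat !ppow_gt0E//.
rewrite (_ : d * _ = y `^ (b - 1) * (d / y * expR (- (d / y)))).
  by rewrite ler_piMr ?powR_ge0// mulr_expRN_le1.
rewrite -[y `^ (b - 1)]gt0_mulr_powRB1//.
rewrite (_ : b - 1 - 1 = b - 2); last by ring.
by field; rewrite gt_eqF.
Qed.

Lemma flat_homo d b : 0 < d -> 0 <= b -> {homo flat d b : x y / x <= y}.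
Proof.
move=> d0 b0 x y xy; have [x0|x0] := leP x 0; first by rewrite flat_le0E// flat_ge0.
have y0 := lt_le_trans x0 xy.
rewrite /flat !ppow_gt0E// ler_pM ?powR_ge0 ?expR_ge0//.
  by rewrite ge0_ler_powR// nnegrE ltW.
by rewrite ler_expR lerN2 ler_pM2l// lef_pV2.
Qed.

(** Increments are not controlled by [flat_le_ppow]. By [dflat_le], however,
    [(b + 1) / b * t ^ b - flat d b t] has a nonnegative derivative for [t > 0], which also explains
    the constant. *)
Lemma flat_increment_le d b x y : 0 < d -> 0 < b -> x <= y ->
  flat d b y - flat d b x <= (b + 1) / b * (ppow b y - ppow b x).
Proof.
move=> d0 b0; rewrite le_eqVlt => /predU1P[->|xy]; first by rewrite !subrr mulr0.
have C1 : 1 <= (b + 1) / b by rewrite ler_pdivlMr// mul1r lerDl.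
have [x0|x0] := leP x 0.
  rewrite (flat_le0E _ _ x0) (ppow_le0E _ x0) !subr0 (le_trans (flat_le_ppow _ _ d0))//.
  by rewrite ler_peMl// ppow_ge0.
pose g t : R := (b + 1) / b * t `^ b - flat d b t.
have dg (t : R) : 0 < t -> is_derive t 1 g ((b + 1) * t `^ (b - 1) - dflat d b t).
  move=> t0; have H1 := is_derive1_powR b t0.
  have H2 := is_derive_flat b t d0.
  apply: is_derive_eq; rewrite /GRing.scale/= /dflat; congr (_ - _).
  by field; rewrite gt_eqF.
have dgxy t : t \in `]x, y[ -> is_derive t 1 g ((b + 1) * t `^ (b - 1) - dflat d b t).
  by rewrite in_itv/= => /andP[xt _]; exact: dg (lt_trans x0 xt).
have cg : {within `[x, y], continuous g}.
  apply: continuous_in_subspaceT => t; rewrite inE/= in_itv/= => /andP[xt _].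
  have [dt _] := dg _ (lt_le_trans x0 xt).
  by apply: differentiable_continuous; exact/derivable1_diffP.
have [c] := @MVT _ g _ x y xy dgxy cg; rewrite in_itv/= => /andP[xc _] gE.
have c0 := lt_trans x0 xc.
have : 0 <= g y - g x.
  rewrite gE mulr_ge0 ?subr_ge0 ?(ltW xy)//.
  by rewrite (le_trans (dflat_le _ d0 (ltW b0)))// ppow_gt0E.
by rewrite /g !ppow_gt0E ?(lt_trans x0 xy)//; lra.
Qed.

Lemma cvg_expR_harmonic (y : R) : expR (- (n.+1%:R^-1 / y)) @[n --> \oo] --> (1 : R).
Proof.
rewrite -[X in _ --> X](@expR0 R) -oppr0 -[0 in X in _ --> X](mul0r y^-1).
apply: cvg_expR.
by apply: cvgN; apply: cvgM; [exact: cvg_harmonic|exact: cvg_cst].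
Qed.

Lemma cvg_flat_harmonic b y : flat n.+1%:R^-1 b y @[n --> \oo] --> ppow b y.
Proof.
rewrite -[X in _ --> X]mulr1; apply: cvgM; first exact: cvg_cst.
exact: cvg_expR_harmonic.
Qed.

Lemma cvg_dflat_harmonic b y : dflat n.+1%:R^-1 b y @[n --> \oo] --> b * ppow (b - 1) y.
Proof.
rewrite -[X in _ --> X]addr0; apply: cvgD.
  by apply: cvgM; [exact: cvg_cst|exact: cvg_flat_harmonic].
rewrite -[X in _ --> X](mul0r (ppow (b - 2) y)); apply: cvgM.
  exact: cvg_harmonic.
exact: cvg_flat_harmonic.
Qed.

Lemma cutoff_le1 y : flat 1 0 y <= 1.
Proof. by rewrite (le_trans (flat_le_ppow _ _ _))// /ppow powRr0; case: ifP. Qed.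

(** With [z = 1 / y] the derivative is [z ^ 2 * expR (- z)], and [expR z >= 1 + z ^ 2 / 2]. *)
Lemma dcutoff_le2 y : `|dflat 1 0 y| <= 2.
Proof.
have [y0|y0] := leP y 0; first by rewrite dflat_le0E// normr0.
rewrite ger0_norm ?dflat_ge0// /dflat mul0r add0r mul1r sub0r /flat ppow_gt0E//.
rewrite powR_invn ?(ltW y0)// expRN -invfM -[leRHS]invrK.
rewrite lef_pV2 ?posrE ?mulr_gt0 ?exprn_gt0 ?expR_gt0 ?invr_gt0//.
have z0 : 0 <= 1 / y by rewrite divr_ge0// ltW.
have := expR_ge1Dxn 1 z0; rewrite (_ : 2`! = 2%N)// expr_div_n expr1n mul1r => H.
rewrite -ler_pdivrMl ?exprn_gt0//; lra.
Qed.

Lemma cvg_inv_shift x : (x + n%:R)^-1 @[n --> \oo] --> (0 : R).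
Proof.
apply/cvgrPdist_le => e e0; near=> n.
have nx : e^-1 <= x + n%:R.
  by rewrite -lerBlDl; near: n; exact: nbhs_infty_ger.
have xn0 : 0 < x + n%:R by rewrite (lt_le_trans _ nx)// invr_gt0.
by rewrite sub0r normrN gtr0_norm ?invr_gt0// -[leRHS]invrK lef_pV2 ?posrE ?invr_gt0.
Unshelve. all: by end_near. Qed.

Lemma cvg_cutoff x : flat 1 0 (x + n%:R) @[n --> \oo] --> (1 : R).
Proof.
have : expR (- (1 * (x + n%:R)^-1)) @[n --> \oo] --> (1 : R).
  rewrite -[X in _ --> X](@expR0 R) -oppr0 -[0 in X in _ --> X](mulr0 1).
  apply: cvg_expR.
  by apply: cvgN; apply: cvgM; [exact: cvg_cst|exact: cvg_inv_shift].
apply: cvg_trans; apply: near_eq_cvg; near=> n.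
have xn0 : 0 < x + n%:R.
  by rewrite -ltrBlDl sub0r; near: n; exact: nbhs_infty_gtr.
by rewrite /flat ppow_gt0E// powRr0 !mul1r.
Unshelve. all: by end_near. Qed.

Lemma cvg_dcutoff x : dflat 1 0 (x + n%:R) @[n --> \oo] --> (0 : R).
Proof.
have : (x + n%:R)^-1 ^+ 2 * expR (- (1 * (x + n%:R)^-1)) @[n --> \oo] --> (0 : R).
  rewrite -[X in _ --> X](mulr1 0); apply: cvgM.
    rewrite -[X in _ --> X](mulr0 0); under eq_fun do rewrite expr2.
    by apply: cvgM; exact: cvg_inv_shift.
  rewrite -[X in _ --> X](@expR0 R) -oppr0 -[0 in X in _ --> X](mulr0 1).
  apply: cvg_expR.
  by apply: cvgN; apply: cvgM; [exact: cvg_cst|exact: cvg_inv_shift].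
apply: cvg_trans; apply: near_eq_cvg; near=> n.
have xn0 : 0 < x + n%:R.
  by rewrite -ltrBlDl sub0r; near: n; exact: nbhs_infty_gtr.
rewrite /dflat mul0r add0r mul1r sub0r /flat ppow_gt0E//.
by rewrite powR_invn ?(ltW xn0)// exprVn !mul1r.
Unshelve. all: by end_near. Qed.

End flat_step.

Lemma is_derive_flat_sub {R : realType} d b c (x : R) : 0 < d ->
  is_derive x 1 (fun x => flat d b (c - x)) (- dflat d b (c - x)).
Proof.
move=> d0; have H := is_derive_flat_affine b (-1) c x d0.
rewrite (_ : (fun x => _) = fun x => flat d b (-1 * x + c)); last first.
  by apply/funext => y; rewrite mulN1r addrC.
by apply: is_derive_eq; rewrite -/(dflat _ _ _) !mulN1r [- x + c]addrC.
Qed.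

(** * The approximating test functions *)

Section bump_fun.
Context {R : realType}.
Notation mu := (@lebesgue_measure R).
Variables al a b : R.
Hypotheses (al0 : (0 : R) < al) (al1 : al < (1 : R)) (ab : a <= b).
Implicit Types (n : nat) (x : R).

Definition jump x : R := ppow al (b - x) - ppow al (a - x).

(* The fractional integral of the indicator function of [a, b[ is [jump] up to
   a constant; [bump_fun n] is a smooth, compactly supported approximation. *)
Definition bump_fun n x : R :=
  (flat n.+1%:R^-1 al (b - x) - flat n.+1%:R^-1 al (a - x)) * flat 1 0 (x + n%:R).

Definition dbump n x : R :=
  - (dflat n.+1%:R^-1 al (b - x) - dflat n.+1%:R^-1 al (a - x)) * flat 1 0 (x + n%:R)
  + (flat n.+1%:R^-1 al (b - x) - flat n.+1%:R^-1 al (a - x)) * dflat 1 0 (x + n%:R).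

(** A majorant of [dbump n] that is free of [n]: [al + 1] comes from [dflat_le], 2 from
    [dcutoff_le2] and [(al + 1) / al] from [flat_increment_le]. *)
Definition dbump_bound x : R := (al + 1) * (ppow (al - 1) (b - x) + ppow (al - 1) (a - x)) +
  2 * ((al + 1) / al * jump x).

Let dn0 n : 0 < n.+1%:R^-1 :> R. Proof. by rewrite invr_gt0. Qed.

Lemma elementary_bump n : elementary (bump_fun n).
Proof.
rewrite (_ : bump_fun n = fun x => (flat n.+1%:R^-1 al (-1 * x + b) +
  -1 * flat n.+1%:R^-1 al (-1 * x + a)) * flat 1 0 (1 * x + n%:R)).
  apply: elementary_mul; last exact: elementary_flat.
  apply: elementary_add; first exact: elementary_flat.
  by apply: elementary_scale; exact: elementary_flat.
apply/funext => x; rewrite /bump_fun !mulN1r mul1r.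
by rewrite [- x + b]addrC [- x + a]addrC.
Qed.

Lemma is_derive_bump n x : is_derive x 1 (bump_fun n) (dbump n x).
Proof.
have H3 : is_derive x 1 (fun x => flat 1 0 (x + n%:R)) (dflat 1 0 (x + n%:R)).
  have H := is_derive_flat_affine 0 1 n%:R x ltr01.
  rewrite (_ : (fun x => _) = fun x => flat 1 0 (1 * x + n%:R)); last first.
    by apply/funext => y; rewrite mul1r.
  by apply: is_derive_eq; rewrite -/(dflat _ _ _) !mul1r.
have H1 := is_derive_flat_sub al b x (dn0 n).
have H2 := is_derive_flat_sub al a x (dn0 n).
rewrite /bump_fun; apply: is_derive_eq; rewrite /GRing.scale/= /dbump; ring.
Qed.

Lemma derive1_bump n : derive1 (bump_fun n) = dbump n.
Proof. by apply/funext => x; rewrite derive1E; have [_ ->] := is_derive_bump n x. Qed.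

Lemma continuous_bump n : continuous (bump_fun n).
Proof. exact: elementary_continuous (elementary_bump n). Qed.

Lemma continuous_dbump n : continuous (dbump n).
Proof.
have [g eg dg] := elementary_derive (elementary_bump n).
rewrite -derive1_bump (_ : derive1 _ = g); first exact: elementary_continuous.
by apply/funext => x; rewrite derive1E; have [_ ->] := dg x.
Qed.

Lemma measurable_bump n : measurable_fun setT (bump_fun n).
Proof. by apply: continuous_measurable_fun; exact: continuous_bump. Qed.

Lemma measurable_dbump n : measurable_fun setT (dbump n).
Proof. by apply: continuous_measurable_fun; exact: continuous_dbump. Qed.

Lemma bump_support n x : bump_fun n x != 0 -> - n%:R <= x <= b.
Proof.
apply: contraNT; rewrite negb_and -!ltNge /bump_fun => /orP[xn|bx].
  by rewrite [flat 1 0 _]flat_le0E ?mulr0// -lerBrDr sub0r ltW.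
have bx0 : b - x <= 0 by rewrite subr_le0 ltW.
have ax0 : a - x <= 0 by rewrite subr_le0 (le_trans ab)// ltW.
by rewrite ![flat _ al _]flat_le0E// subrr mul0r.
Qed.

Lemma dbump_support n x : dbump n x != 0 -> - n%:R <= x <= b.
Proof.
apply: contraNT; rewrite negb_and -!ltNge /dbump => /orP[xn|bx].
  have xn0 : x + n%:R <= 0 by rewrite -lerBrDr sub0r ltW.
  by rewrite [flat 1 0 _]flat_le0E// [dflat 1 0 _]dflat_le0E// !mulr0 addr0.
have bx0 : b - x <= 0 by rewrite subr_le0 ltW.
have ax0 : a - x <= 0 by rewrite subr_le0 (le_trans ab)// ltW.
by rewrite ![flat _ al _]flat_le0E// ![dflat _ al _]dflat_le0E// !subrr oppr0 !mul0r addr0.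
Qed.

Lemma test_function_bump n : test_function (bump_fun n).
Proof.
split; first exact: elementary_smooth (elementary_bump n).
exact: compact_support_itv (@bump_support n).
Qed.

Let al_ge0 := ltW al0.

Let abx x : a - x <= b - x. Proof. by rewrite lerD2r. Qed.

Lemma jump_ge0 x : 0 <= jump x.
Proof.
rewrite /jump subr_ge0; have [ax|ax] := leP (a - x) 0.
  by rewrite ppow_le0E// ppow_ge0.
by rewrite !ppow_gt0E ?(lt_le_trans ax)// ge0_ler_powR// nnegrE ltW// (lt_le_trans ax).
Qed.

Let step_le n x :
  `|flat n.+1%:R^-1 al (b - x) - flat n.+1%:R^-1 al (a - x)| <= (al + 1) / al * jump x.
Proof.
rewrite ger0_norm ?subr_ge0; last exact: flat_homo.
exact: flat_increment_le.
Qed.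

Lemma bump_le n x : `|bump_fun n x| <= (al + 1) / al * jump x.
Proof.
rewrite normrM -[leRHS]mulr1 ler_pM//.
by rewrite ger0_norm ?flat_ge0// cutoff_le1.
Qed.

Lemma dbump_le n x : `|dbump n x| <= dbump_bound x.
Proof.
rewrite (le_trans (ler_normD _ _))// lerD//.
  rewrite normrM normrN -[leRHS]mulr1 ler_pM//.
    rewrite (le_trans (ler_normB _ _))// mulrDr lerD//.
      by rewrite ger0_norm ?dflat_ge0// dflat_le.
    by rewrite ger0_norm ?dflat_ge0// dflat_le.
  by rewrite ger0_norm ?flat_ge0// cutoff_le1.
by rewrite normrM mulrC ler_pM// dcutoff_le2.
Qed.

(** The derivative of the cutoff tends to 0, so the limit is the derivative of [jump] away from [a]
    and [b]. *)
Lemma cvg_dbump x : dbump n x @[n --> \oo] -->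
  - (al * ppow (al - 1) (b - x) - al * ppow (al - 1) (a - x)).
Proof.
rewrite -[X in _ --> X]mulr1 -[X in _ --> X]addr0.
rewrite -[0 in X in _ --> X](mulr0 (jump x)); apply: cvgD; apply: cvgM.
- by apply: cvgN; apply: cvgB; exact: cvg_dflat_harmonic.
- exact: cvg_cutoff.
- by apply: cvgB; exact: cvg_flat_harmonic.
- exact: cvg_dcutoff.
Qed.

Lemma integral_ppow_shift x d :
  (\int[mu]_(z in `]-oo, d[) (al * ppow (al - 1) (z - x))%:E = (ppow al (d - x))%:E)%E.
Proof.
rewrite -integral_bool_Iio.
pose f (t : R) := (al * ppow (al - 1) t * (t < d - x)%R%:R)%:E.
transitivity (\int[mu]_t f (1 * t - x)%R)%E.
  by apply: eq_integral => t _; rewrite /f mul1r ltrD2r.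
rewrite -integral_isometry ?normr1//; last by rewrite /f; measurability.
transitivity (\int[mu]_t (al%:E * (ppow (al - 1) t * (t < d - x)%R%:R)%:E))%E.
  by apply: eq_integral => t _; rewrite /f -EFinM mulrA.
rewrite ge0_integralTZl//; last 2 first.
- by measurability.
- by move=> t; rewrite lee_fin mulr_ge0 ?ppow_ge0.
rewrite integral_bool_Iio integral_ppow_lt// -EFinM mulrA mulfV ?mul1r//.
by rewrite gt_eqF.
Qed.

Lemma integral_jump x :
  (\int[mu]_(z in `[a, b[) (al * ppow (al - 1) (z - x))%:E = (jump x)%:E)%E.
Proof.
have abE : `]-oo, b[%classic = `]-oo, a[%classic `|` `[a, b[%classic.
  apply/seteqP; split => z /=; rewrite !in_itv/=; last first.
    by move=> [/lt_le_trans|/andP[_ ->]//]; apply.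
  by move=> zb; have [za|az] := ltP z a; [left|right; rewrite zb].
have := integral_ppow_shift x b; rewrite abE ge0_integral_setU//=.
- rewrite integral_ppow_shift /jump EFinB => <-.
  (* The integral up to [a] is finite and so may be cancelled in the extended reals. *)
  by rewrite addeAC subee// add0e.
- by apply/measurable_EFinP; apply: measurable_funTS; measurability.
- by move=> z _; rewrite lee_fin mulr_ge0 ?ppow_ge0.
- apply/disj_setPS => z /= []; rewrite !in_itv/= => za /andP[az _].
  by move: za; rewrite ltNge az.
Qed.

End bump_fun.

(** * Fractional derivatives of the test functions *)

Section derive_fractional_integral.
Context {R : realType}.
Notation mu := (@lebesgue_measure R).
Variables (al M S : R) (phi dphi : R -> R).
Hypotheses (al0 : (0 : R) < al) (al1 : al < (1 : R)) (M0 : 0 <= M).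
Hypothesis dphiP : forall x : R, is_derive x 1 phi (dphi x).
Hypotheses (mphi : measurable_fun setT phi) (mdphi : measurable_fun setT dphi).
Hypotheses (phiM : forall x, `|phi x| <= M) (dphiM : forall x, `|dphi x| <= M).
Hypotheses (phiS : forall x, S < x -> phi x = 0) (dphiS : forall x, S < x -> dphi x = 0).

(** Moves the parameter from the singular kernel to the smooth factor, the form in which one can
    differentiate under the integral. *)
Lemma translate_fractional_integral (psi : R -> R) z : measurable_fun setT psi ->
  \int[mu]_y (ppow (- al) (y - z) * psi y) = \int[mu]_t (ppow (- al) t * psi (z + t)).
Proof.
move=> mpsi; rewrite /Rintegral; congr fine.
rewrite (@integral_isometry R (fun y => (ppow (- al) (y - z) * psi y)%:E) 1 z) ?normr1//.
  by apply: eq_integral => t _; rewrite mul1r addrK [t + z]addrC.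
by measurability.
Qed.

Lemma right_fractional_integralE z :
  \int[mu]_(y in `[z, +oo[) (phi y / (y - z) `^ al) =
  \int[mu]_y (ppow (- al) (y - z) * phi y).
Proof.
rewrite Rintegral_mkcond; apply: eq_Rintegral => y _; rewrite patchE.
case: ifPn => [|/negP]; rewrite inE/= in_itv/= andbT => zy.
  have [yz|yz] := ltP z y; first by rewrite ppow_gt0E ?subr_gt0// powRN mulrC.
  (* At the singular point both integrands take the default value 0. *)
  have -> : y = z by apply/eqP; rewrite eq_le zy yz.
  by rewrite subrr powR0 ?gt_eqF// invr0 mulr0 ppow_le0E// mul0r.
by rewrite ppow_le0E ?mul0r// subr_le0 leNgt; apply/negP => /ltW.
Qed.

Lemma is_derive_right_fractional_integral (x : R) :
  is_derive x 1 (fun z => \int[mu]_(y in `[z, +oo[) (phi y / (y - z) `^ al))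
    (\int[mu]_y (ppow (- al) (y - x) * dphi y)).
Proof.
rewrite (_ : (fun z => _) = fun z => \int[mu]_t (ppow (- al) t * phi (z + t))); last first.
  apply/funext => z.
  by rewrite right_fractional_integralE translate_fractional_integral.
rewrite translate_fractional_integral//.
pose f z t := ppow (- al) t * phi (z + t).
(* For [z > x - 1] and [t >= T] one has [z + t > S], where [phi] and [dphi] vanish. Hence the single
   integrable majorant [G] serves all [z] near [x], for the function and for its derivative. *)
pose T := S - x + 1.
pose G t := M * (ppow ((1 - al) - 1) t * (t < T)%R%:R).
have fE : (1 - al) - 1 = - al by ring.
have d1f (z t : R) : is_derive z 1 (f ^~ t) (ppow (- al) t * dphi (z + t)).
  have H1 : is_derive z 1 (fun z => z + t) 1.
    by apply: is_derive_eq; rewrite addr0.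
  have H2 := @is_derive1_comp _ phi (fun z => z + t) z _ _ (dphiP (z + t)) H1.
  by rewrite /f; apply: is_derive_eq; rewrite /GRing.scale/= mulr1.
have d1fE (z t : R) : partial1of2 f z t = ppow (- al) t * dphi (z + t).
  by rewrite partial1of2E; have [_ ->] := d1f z t.
have G0 t : 0 <= G t by rewrite mulr_ge0// mulr_ge0// ppow_ge0.
have mG : measurable_fun setT G by rewrite /G; measurability.
have intG : mu.-integrable setT (EFin \o G).
  apply/integrableP; split; first by apply/measurable_EFinP.
  rewrite (_ : (\int[mu]_t `|(EFin \o G) t|)%E =
      (\int[mu]_t (M%:E * (ppow ((1 - al) - 1) t * (t < T)%R%:R)%:E))%E); last first.
    by apply: eq_integral => t _; rewrite /= ger0_norm ?G0.
  rewrite ge0_integralTZl//; last 2 first.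
  - by measurability.
  - by move=> t; rewrite lee_fin mulr_ge0// ppow_ge0.
  by rewrite integral_bool_Iio integral_ppow_lt ?subr_gt0// -EFinM ltry.
have le_G (psi : R -> R) z t : x - 1 < z -> (forall x, `|psi x| <= M) ->
    (forall x, S < x -> psi x = 0) -> `|ppow (- al) t * psi (z + t)| <= G t.
  move=> xz psiM psiS; rewrite /G fE normrM ger0_norm ?ppow_ge0//.
  have [tT|Tt] := ltP t T; first by rewrite mulr1 mulrC ler_pM ?ppow_ge0.
  rewrite psiS; first by rewrite normr0 !mulr0.
  by rewrite /T in Tt; lra.
have mf z : measurable_fun setT (f z).
  apply: measurable_funM; first exact: measurable_ppow.
  by apply: (measurableT_comp mphi); exact: measurable_funD.
have Ix : `]x - 1, x + 1[%classic x by rewrite /= in_itv/=; lra.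
have intf z : `]x - 1, x + 1[%classic z -> mu.-integrable setT (EFin \o f z).
  rewrite /= in_itv/= => /andP[xz _].
  apply: le_integrable intG => //; first by apply/measurable_EFinP; exact: mf.
  by move=> t _; rewrite lee_fin (ger0_norm (G0 _)) le_G.
have derf z t : `]x - 1, x + 1[%classic z -> [set: R] t -> derivable (f ^~ t) z 1.
  by move=> _ _; have [] := d1f z t.
have leG z t : `]x - 1, x + 1[%classic z -> [set: R] t -> `|partial1of2 f z t| <= G t.
  by rewrite /= in_itv/= => /andP[xz _] _; rewrite d1fE le_G.
apply: DeriveDef.
  exact: (@derivable_under_integral _ _ _ mu f setT measurableT x _ _ Ix intf derf G G0 intG leG).
rewrite -derive1E.
rewrite (@differentiation_under_integral _ _ _ mu f setT measurableT x _ _ Ix intf derf G G0 intG leG).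
by apply: eq_Rintegral => t _; rewrite d1fE.
Qed.

End derive_fractional_integral.

(** * The approximations and their reflections *)

Section frac_deriv_bump.
Context {R : realType}.
Notation mu := (@lebesgue_measure R).
Variables al a b : R.
Hypotheses (al0 : (0 : R) < al) (al1 : al < (1 : R)) (ab : a <= b).
Implicit Types (n : nat) (x : R).

Definition kbump n x : R := \int[mu]_y (ppow (- al) (y - x) * dbump al a b n y).

Lemma is_derive_integral_bump n x :
  is_derive x 1 (fun z => \int[mu]_(y in `[z, +oo[) (bump_fun al a b n y / (y - z) `^ al))
    (kbump n x).
Proof.
have [M1 M10 M1P] := continuous_bounded_support
  (@continuous_bump _ al a b n) (@bump_support _ al a b ab n).
have [M2 M20 M2P] := continuous_bounded_support
  (@continuous_dbump _ al a b n) (@dbump_support _ al a b ab n).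
apply: (@is_derive_right_fractional_integral _ al (M1 + M2) b) => //.
- by rewrite addr_ge0 ?ltW.
- exact: is_derive_bump.
- exact: measurable_bump.
- exact: measurable_dbump.
- by move=> y; rewrite (le_trans (M1P y))// lerDl ltW.
- by move=> y; rewrite (le_trans (M2P y))// lerDr ltW.
- move=> y yb; apply/eqP; apply: contraT => /(@bump_support _ al a b ab)/andP[_].
  by rewrite leNgt yb.
- move=> y yb; apply/eqP; apply: contraT => /(@dbump_support _ al a b ab)/andP[_].
  by rewrite leNgt yb.
Qed.

Lemma frac_deriv_bump n x :
  frac_deriv right_side al (bump_fun al a b n) x = - (Gamma (1 - al))^-1 * kbump n x.
Proof.
by rewrite /frac_deriv derive1E; have [_ ->] := is_derive_integral_bump n x.
Qed.

(** Reflection exchanges the two half-lines; the minus sign of the chain rule makes up for the sign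
    that distinguishes the two fractional derivatives. *)
Lemma frac_deriv_bump_opp n x :
  frac_deriv left_side al (bump_fun al a b n \o -%R) x =
  - (Gamma (1 - al))^-1 * kbump n (- x).
Proof.
rewrite /frac_deriv.
pose H w := \int[mu]_(y in `[w, +oo[) (bump_fun al a b n y / (y - w) `^ al).
rewrite (_ : (fun z => _) = fun z => H (- z)); last first.
  apply/funext => z.
  rewrite /H /Rintegral; apply: congr1.
  rewrite integral_mkcond [RHS]integral_mkcond.
  pose F : R -> \bar R :=
    (fun y => (bump_fun al a b n y * (y + z) `^ (- al))%:E) \_ `[- z, +oo[.
  have mb := @measurable_bump _ al a b n.
  have mF : measurable_fun setT F.
    apply/(measurable_restrictT _ _).1 => //; apply: measurable_funTS.
    by measurability.
  transitivity (\int[mu]_y F (-1 * y + 0)%R)%E; last first.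
    rewrite -integral_isometry ?normrN1//; apply: eq_integral => y _.
    by rewrite /F !patchE opprK; case: ifP => // _; rewrite powRN.
  apply: eq_integral => y _; rewrite /F addr0 mulN1r !patchE [- y + z]addrC powRN.
  by rewrite !mem_setE !in_itv/= andbT lerN2.
have dH : is_derive x 1 (fun z => H (- z)) (- kbump n (- x)).
  have H1 : is_derive x 1 (-%R : R -> R) (-1) by apply: is_derive_eq.
  have H2 := is_derive_integral_bump n (- x).
  have := @is_derive1_comp _ H -%R x _ _ H2 H1.
  by rewrite mulrN1.
by rewrite derive1E; have [_ ->] := dH; rewrite mulrN mulNr.
Qed.

Lemma elementary_opp (f : R -> R) : elementary f -> elementary (f \o -%R).
Proof.
elim => [d e s c d0|{}f g _ ef _ eg|{}f g _ ef _ eg|k {}f _ ef].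
- rewrite (_ : _ \o _ = fun x => flat d e (- s * x + c)); first exact: elementary_flat.
  by apply/funext => x /=; rewrite mulrN mulNr.
- exact: (elementary_add ef eg).
- exact: (elementary_mul ef eg).
- exact: (elementary_scale k ef).
Qed.

Lemma test_function_bump_opp n : test_function (bump_fun al a b n \o -%R).
Proof.
split; first exact/elementary_smooth/elementary_opp/elementary_bump.
apply: (@compact_support_itv _ _ (- b) n%:R) => x /= /(@bump_support _ al a b ab).
by rewrite lerNl opprK lerNl andbC.
Qed.

Lemma measurable_Rintegral_line (f : R -> R -> R) :
  measurable_fun setT (fun z : R * R => f z.1 z.2) ->
  measurable_fun setT (fun x => \int[mu]_y f x y).
Proof.
move=> mf; rewrite /Rintegral.
apply: (measurableT_comp (fine_measurable measurableT)).
under eq_fun do rewrite integralE.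
have mfE : measurable_fun setT (fun z : R * R => (f z.1 z.2)%:E) by exact/measurable_EFinP.
apply: emeasurable_funB; apply: measurable_integral_line.
- rewrite (_ : (fun z => _) = (fun z : R * R => (f z.1 z.2)%:E)^\+%E);
    first exact: measurable_funepos mfE.
  by apply/funext => z; rewrite !funeposE.
- by move=> x y; exact: funepos_ge0.
- rewrite (_ : (fun z => _) = (fun z : R * R => (f z.1 z.2)%:E)^\-%E);
    first exact: measurable_funeneg mfE.
  by apply/funext => z; rewrite !funenegE.
- by move=> x y; exact: funeneg_ge0.
Qed.

Lemma measurable_kbump n : measurable_fun setT (kbump n).
Proof.
apply: (measurable_Rintegral_line (f := fun x y => ppow (- al) (y - x) * dbump al a b n y)).
have mb := @measurable_dbump _ al a b n.
by measurability.
Qed.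

Lemma Rintegral_opp (f : R -> R) : measurable_fun setT f ->
  \int[mu]_x f x = \int[mu]_x f (- x).
Proof.
move=> mf; have mF : measurable_fun setT (EFin \o f) by exact/measurable_EFinP.
by rewrite /Rintegral; apply: congr1; exact: esym (integral_reflect mF).
Qed.

End frac_deriv_bump.

(** * Passage to the limit *)

Section kernel_limits.
Context {R : realType}.
Notation mu := (@lebesgue_measure R).
Variables al a b : R.
Hypotheses (al0 : (0 : R) < al) (al1 : al < (1 : R)) (ab : a <= b).
Implicit Types (n : nat) (x y z : R) (f : R -> R).

Lemma integral_itv_mask (f : R -> \bar R) :
  (\int[mu]_(z in `[a, b[) f z = \int[mu]_z (f z * ((a <= z)%R%:R * (z < b)%R%:R)%:E))%E.
Proof.
rewrite integral_mkcond; apply: eq_integral => z _.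
rewrite patchE mem_setE in_itv/= -natrM mulnb.
by case: ifP => _; rewrite ?mule1 ?mule0.
Qed.

Lemma measurable_jump : measurable_fun setT (jump al a b).
Proof. by rewrite /jump; measurability. Qed.

(** Tonelli's theorem after writing [jump] as an integral over [[a, b[] by [integral_jump]. *)
Lemma integral_mul_jump f : measurable_fun setT f -> (forall x, 0 <= f x) ->
  (\int[mu]_y (f y * jump al a b y)%:E =
   al%:E * \int[mu]_(z in `[a, b[) riesz al f z)%E.
Proof.
move=> mf f0.
pose g y z : \bar R := (f y * (al * ppow (al - 1) (z - y)) * ((a <= z)%R%:R * (z < b)%R%:R))%:E.
have g0 y z : (0 <= g y z)%E.
  by rewrite lee_fin !mulr_ge0 ?ppow_ge0 ?(ltW al0).
have mg : measurable_fun setT (fun z : R * R => g z.1 z.2) by rewrite /g; measurability.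
transitivity (\int[mu]_y \int[mu]_z g y z)%E.
  apply: eq_integral => y _.
  rewrite EFinM -(integral_jump al0 ab) integral_itv_mask -ge0_integralTZl//.
  - by apply: eq_integral => z _; rewrite -!EFinM /g mulrA.
  - by apply: emeasurable_funM; measurability.
  - by move=> z; rewrite -EFinM lee_fin !mulr_ge0 ?ppow_ge0 ?(ltW al0).
rewrite (tonelli_line mg g0) integral_itv_mask -ge0_integralTZl ?(ltW al0)//; first last.
- move=> z; rewrite mule_ge0 ?riesz_ge0// lee_fin mulr_ge0//.
- apply: emeasurable_funM; first exact: measurable_riesz.
  by measurability.
apply: eq_integral => z _.
transitivity (\int[mu]_y ((al * ((a <= z)%R%:R * (z < b)%R%:R))%:E * (ppow (al - 1) (z - y) * f y)%:E))%E.
  by apply: eq_integral => y _; rewrite -EFinM /g; congr EFin; ring.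
rewrite ge0_integralTZl.
- by rewrite -/(riesz al f z) [in LHS](EFinM al) -muleA [X in (_ * X)%E = _]muleC.
- by rewrite !mulr_ge0 ?(ltW al0).
- by measurability.
- by move=> y; rewrite lee_fin mulr_ge0 ?ppow_ge0.
Qed.

Let c := fine (beta_cst al).

Lemma beta_cstK : beta_cst al = c%:E.
Proof. by rewrite /c fineK// ge0_fin_numE ?beta_cst_lty// ltW// beta_cst_gt0. Qed.

(** Each singular power in [dbump_bound] contributes a Beta integral, at most [c] for every [x]; the
    remaining part is a multiple of [jump]. *)
Lemma integral_kernel_dbump_bound : exists2 D : R, 0 <= D & forall x,
  (\int[mu]_y (ppow (- al) (y - x) * dbump_bound al a b y)%:E <= D%:E)%E.
Proof.
have c0 : 0 <= c by rewrite fine_ge0// ltW// beta_cst_gt0.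
have al10 : (0 : R) <= al + 1 by rewrite addr_ge0 ?(ltW al0).
have aa0 : (0 : R) <= (al + 1) / al by rewrite divr_ge0 ?(ltW al0).
have E0 z x : (\int[mu]_y (ppow (- al) (y - x) * ppow (al - 1) (z - y))%:E <= c%:E)%E.
  by rewrite integral_beta; case: ifP => _; rewrite ?beta_cstK// lee_fin.
pose J x := (\int[mu]_y (ppow (- al) (y - x) * jump al a b y)%:E)%E.
have JE x : (J x <= (al * (c * (b - a)))%:E)%E.
  have mk : measurable_fun setT (fun y => ppow (- al) (y - x)) by measurability.
  (* Here the kernel itself is the function whose potential is taken, and this potential is again a
     Beta integral. *)
  rewrite /J integral_mul_jump//; last by move=> y; exact: ppow_ge0.
  rewrite [leRHS]EFinM; apply: lee_pmul => //; rewrite ?lee_fin ?(ltW al0)//.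
    by apply: integral_ge0 => z _; apply: riesz_ge0 => y; exact: ppow_ge0.
  apply: (@le_trans _ _ (\int[mu]_(z in `[a, b[) c%:E)%E).
    apply: ge0_le_integral => //.
    - by move=> z _; apply: riesz_ge0 => y; exact: ppow_ge0.
    - apply: measurable_funTS; apply: measurable_riesz => // y; exact: ppow_ge0.
    - move=> z _; apply: le_trans (E0 z x); rewrite le_eqVlt; apply/orP; left; apply/eqP.
      by apply: eq_integral => y _; rewrite mulrC.
  rewrite integral_cst//= [X in (_ * X)%E](lebesgue_measure_itv `[a, b[)/= lte_fin.
  by case: ifPn => [_|]; rewrite ?EFinM// mule0 lee_fin mulr_ge0 ?subr_ge0.
exists ((al + 1) * (c + c) + 2 * ((al + 1) / al * (al * (c * (b - a))))).
  by rewrite addr_ge0// !mulr_ge0 ?subr_ge0 ?invr_ge0 ?addr_ge0 ?(ltW al0).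
move=> x.
pose K z y := (ppow (- al) (y - x) * ppow (al - 1) (z - y))%:E.
have K0 z y : (0 <= K z y)%E by rewrite lee_fin mulr_ge0 ?ppow_ge0.
have mK z : measurable_fun setT (K z) by rewrite /K; measurability.
have mj := measurable_jump.
have mJ : measurable_fun setT (fun y => (ppow (- al) (y - x) * jump al a b y)%:E).
  by measurability.
have J0 y : (0 <= (ppow (- al) (y - x) * jump al a b y)%:E)%E.
  by rewrite lee_fin mulr_ge0 ?ppow_ge0 ?jump_ge0.
have -> : (\int[mu]_y (ppow (- al) (y - x) * dbump_bound al a b y)%:E)%E =
  (\int[mu]_y ((al + 1)%:E * (K b y + K a y) +
    (2 * ((al + 1) / al))%:E * (ppow (- al) (y - x) * jump al a b y)%:E))%E.
  by apply: eq_integral => y _; congr EFin; rewrite /dbump_bound; ring.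
have mKK : measurable_fun setT (fun y => K b y + K a y)%E by exact: emeasurable_funD.
have KK0 y : (0 <= K b y + K a y)%E by rewrite adde_ge0.
have aa20 : 0 <= 2 * ((al + 1) / al) by rewrite mulr_ge0.
rewrite ge0_integralTD; first last.
- by move=> y; rewrite mule_ge0.
- by move=> y; rewrite mule_ge0.
- by apply: emeasurable_funM => //; exact: measurable_cst.
- by apply: emeasurable_funM => //; exact: measurable_cst.
rewrite !ge0_integralTZl// ge0_integralTD//.
rewrite [in leRHS]mulrA [leRHS]EFinD; apply: leeD; rewrite [leRHS]EFinM.
  by apply: lee_wpmul2l; rewrite ?lee_fin// EFinD leeD ?E0.
by apply: lee_wpmul2l; [rewrite lee_fin|exact: JE].
Qed.

Lemma fine_le_abse (I : \bar R) : (`|fine I|%:E <= `|I|)%E.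
Proof. by case: I => [r| |] //=; rewrite normr0 leey. Qed.

Lemma measurable_kernel_dbump n x :
  measurable_fun setT (fun y => (ppow (- al) (y - x) * dbump al a b n y)%:E).
Proof. by have md := @measurable_dbump _ al a b n; measurability. Qed.

Lemma measurable_kernel_dbump_bound x :
  measurable_fun setT (fun y => (ppow (- al) (y - x) * dbump_bound al a b y)%:E).
Proof. by rewrite /dbump_bound; have mj := measurable_jump; measurability. Qed.

Lemma dbump_bound_ge0 x : 0 <= dbump_bound al a b x.
Proof. exact: le_trans (normr_ge0 _) (dbump_le al0 ab 0 x). Qed.

Lemma kernel_dbump_le n x y :
  (`|(ppow (- al) (y - x) * dbump al a b n y)%:E| <= (ppow (- al) (y - x) * dbump_bound al a b y)%:E)%E.
Proof.
by rewrite lee_fin normrM ger0_norm ?ppow_ge0// ler_wpM2l ?ppow_ge0// dbump_le.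
Qed.

Lemma kbump_bounded : exists2 D : R, 0 <= D & forall n x, `|kbump al a b n x| <= D.
Proof.
have [D D0 DP] := integral_kernel_dbump_bound.
exists D => // n x; rewrite -lee_fin.
apply: le_trans (fine_le_abse _) _.
apply: le_trans (le_abse_integral mu measurableT (measurable_kernel_dbump n x)) _.
apply: le_trans (DP x).
apply: ge0_le_integralT => //.
- exact: measurableT_comp (measurable_kernel_dbump n x).
- exact: measurable_kernel_dbump_bound.
- exact: kernel_dbump_le.
Qed.

Lemma integral_kernel z x :
  (\int[mu]_y (ppow (- al) (y - x) * ppow (al - 1) (z - y))%:E = (c * (x < z)%R%:R)%:E)%E.
Proof.
by rewrite integral_beta beta_cstK; case: ifP => _; rewrite ?mulr1 ?mulr0.
Qed.

Lemma integrable_kernel z x :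
  mu.-integrable setT (fun y => (ppow (- al) (y - x) * ppow (al - 1) (z - y))%:E).
Proof.
apply/integrableP; split; first by measurability.
under eq_integral do rewrite gee0_abs ?lee_fin ?mulr_ge0 ?ppow_ge0//.
by rewrite integral_kernel ltry.
Qed.

Lemma cvg_kbump x : kbump al a b n x @[n --> \oo] -->
  - (al * c) * ((a <= x)%R%:R * (x < b)%R%:R).
Proof.
have [D D0 DP] := integral_kernel_dbump_bound.
have := @dominated_cvg _ _ _ mu _ measurableT
  (fun n y => (ppow (- al) (y - x) * dbump al a b n y)%:E)
  (fun y => (ppow (- al) (y - x) * - (al * ppow (al - 1) (b - y) - al * ppow (al - 1) (a - y)))%:E)
  (fun y => (ppow (- al) (y - x) * dbump_bound al a b y)%:E)
  (fun n => measurable_kernel_dbump n x).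
have -> : (\int[mu]_y (ppow (- al) (y - x) * - (al * ppow (al - 1) (b - y) - al * ppow (al - 1) (a - y)))%:E)%E
   = (- (al * c) * ((a <= x)%R%:R * (x < b)%R%:R))%:E.
  transitivity (\int[mu]_y ((- al)%:E * ((ppow (- al) (y - x) * ppow (al - 1) (b - y))%:E -
       (ppow (- al) (y - x) * ppow (al - 1) (a - y))%:E)))%E.
    by apply: eq_integral => y _; rewrite -EFinB -EFinM; congr EFin; ring.
  rewrite integralZl//; last exact: integrableB (integrable_kernel b x) (integrable_kernel a x).
  rewrite integralB//; [|exact: integrable_kernel..].
  rewrite !integral_kernel -EFinB -EFinM; congr EFin.
  (* For [x < a] the Beta integrals ending at [a] and at [b] cancel; for [a <= x] the one ending at
     [a] is 0. *)
  rewrite leNgt; case: (ltP x a) => [xa|ax] /=; last by ring.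
  by rewrite (lt_le_trans xa ab)/=; ring.
move=> H; apply: fine_cvg; apply: H => //.
- move=> y _; apply: cvg_EFin; first exact: nearW.
  by apply: (cvgM (cvg_cst _) (@cvg_dbump _ al a b y)).
- apply/integrableP; split; first exact: measurable_kernel_dbump_bound.
  under eq_integral do rewrite gee0_abs ?lee_fin ?mulr_ge0 ?ppow_ge0 ?dbump_bound_ge0//.
  by rewrite (le_lt_trans (DP x)) ?ltry.
- by move=> n y _; exact: kernel_dbump_le.
Qed.

(** Dominated convergence with majorant [D * |u|]: the uniform bound of [kbump_bounded] meets the
    integrability of [u]. *)
Lemma cvg_integral_kbump (u : R -> R) : mu.-integrable setT (EFin \o u) ->
  \int[mu]_x (u x * kbump al a b n x) @[n --> \oo] --> - (al * c) * \int[mu]_(x in `[a, b[) u x.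
Proof.
move=> iu; have mu' : measurable_fun setT u by apply/measurable_EFinP; exact: measurable_int iu.
have [D D0 DP] := kbump_bounded.
have mk n := @measurable_kbump R al a b n.
have := @dominated_cvg _ _ _ mu _ measurableT
  (fun n x => (u x * kbump al a b n x)%:E)
  (fun x => (u x * (- (al * c) * ((a <= x)%R%:R * (x < b)%R%:R)))%:E)
  (fun x => (D%:E * `|(EFin \o u) x|)%E).
have -> : (\int[mu]_x (u x * (- (al * c) * ((a <= x)%R%:R * (x < b)%R%:R)))%:E)%E
   = (- (al * c) * \int[mu]_(x in `[a, b[) u x)%:E.
  have iab : mu.-integrable `[a, b[ (EFin \o u) by exact: integrableS iu.
  rewrite EFinM /Rintegral fineK; last exact: integrable_fin_num.
  rewrite -integralZl// integral_itv_mask; apply: eq_integral => x _.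
  by rewrite -!EFinM; congr EFin; ring.
move=> H; apply: fine_cvg; apply: H => //.
- by move=> n; have mkn := mk n; measurability.
- move=> x _; apply: cvg_EFin; first exact: nearW.
  by apply: (cvgM (cvg_cst _) (@cvg_kbump x)).
- by apply: integrableZl => //; exact: integrable_abse.
- by move=> n x _; rewrite lee_fin normrM mulrC ler_wpM2r.
Qed.

(** The factor [(al + 1) / al] of [bump_le] times the [al] of [integral_mul_jump]. The bound is free
    of [n], so [v] need not be integrable against a limit. *)
Lemma integral_bump_le n (v : R -> R) : measurable_fun setT v ->
  (`|\int[mu]_x (v x * bump_fun al a b n x)|%:E <=
   (al + 1)%:E * \int[mu]_(x in `[a, b[) riesz al (fun y => `|v y|)%R x)%E.
Proof.
move=> mv; apply: le_trans (fine_le_abse _) _.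
have mb := @measurable_bump _ al a b n.
have mj := measurable_jump.
have mvb : measurable_fun setT (fun x => (v x * bump_fun al a b n x)%:E) by measurability.
apply: le_trans (le_abse_integral mu measurableT mvb) _.
have mvj : measurable_fun setT (fun x => (`|v x| * jump al a b x)%:E) by measurability.
apply: (@le_trans _ _ (\int[mu]_x (((al + 1) / al)%:E * (`|v x| * jump al a b x)%:E))%E).
  apply: ge0_le_integralT => //.
  - exact: measurableT_comp mvb.
  - by apply: emeasurable_funM.
  - move=> x; rewrite -EFinM lee_fin normrM mulrCA ler_wpM2l//.
    exact: bump_le.
have a10 : (0 : R) <= (al + 1) / al by rewrite divr_ge0 ?addr_ge0 ?(ltW al0).
rewrite ge0_integralTZl//; last by move=> x; rewrite lee_fin mulr_ge0 ?jump_ge0.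
rewrite (@integral_mul_jump (fun x => `|v x|))//; last exact: measurableT_comp.
by rewrite muleA -EFinM divfK ?gt_eqF.
Qed.

Lemma Rintegral_itv_le (u v : R -> R) : mu.-integrable setT (EFin \o u) ->
  measurable_fun setT v ->
  (forall n, \int[mu]_x (v x * bump_fun al a b n x) =
     \int[mu]_x (u x * (- (Gamma (1 - al))^-1 * kbump al a b n x))) ->
  (`|\int[mu]_(x in `[a, b[) u x|%:E <=
   ((al + 1) * Gamma (1 - al) / (al * c))%:E *
     \int[mu]_(x in `[a, b[) riesz al (fun y => `|v y|)%R x)%E.
Proof.
move=> iu mv uv.
set I := (\int[mu]_(x in `[a, b[) riesz al (fun y => `|v y|)%R x)%E.
have G0 := Gamma_gt0 al0 al1.
have c0 : 0 < c by rewrite fine_gt0// beta_cst_gt0// beta_cst_lty.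
have alc0 : 0 < al * c by rewrite mulr_gt0.
have I0 : (0 <= I)%E by apply: integral_ge0 => x _; exact: riesz_ge0.
have al10 : (0 : R) < al + 1 by rewrite addr_gt0.
have C0 : 0 < (al + 1) * Gamma (1 - al) / (al * c) by rewrite divr_gt0 ?mulr_gt0.
(* An infinite [I] makes the claim trivial; otherwise the bounds [B n] are real and pass to the
   limit. *)
have [->|Ioo] := eqVneq I +oo%E; first by rewrite gt0_muley ?lte_fin ?leey.
have If : I \is a fin_num by rewrite ge0_fin_numE// ltey.
have B n : `|\int[mu]_x (u x * kbump al a b n x)| <= (al + 1) * Gamma (1 - al) * fine I.
  have -> : \int[mu]_x (u x * kbump al a b n x) =
     - Gamma (1 - al) * \int[mu]_x (v x * bump_fun al a b n x).
    rewrite uv.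
    (* Integrability is established in order to take the constant out of the [Rintegral]. *)
    have [D D0 DP] := kbump_bounded.
    have ik : mu.-integrable setT (EFin \o (fun x => u x * kbump al a b n x)).
      apply: (@le_integrable _ _ _ mu setT _ _ (fun x => (D%:E * (EFin \o u) x)%E)) => //.
      - apply/measurable_EFinP; apply: measurable_funM; last exact: measurable_kbump.
        by apply/measurable_EFinP; exact: measurable_int iu.
      - by move=> x _ /=; rewrite lee_fin !normrM (ger0_norm D0) mulrC ler_wpM2r.
      - exact: integrableZl.
    under [in RHS]eq_Rintegral do rewrite mulrCA.
    by rewrite RintegralZl// mulrA mulrNN divff ?gt_eqF// mul1r.
  rewrite normrM normrN (gtr0_norm G0) mulrC mulrAC ler_wpM2r ?(ltW G0)//.
  by rewrite -lee_fin EFinM fineK//; exact: integral_bump_le.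
have L := cvg_norm (@cvg_integral_kbump u iu).
have : `|- (al * c) * \int[mu]_(x in `[a, b[) u x| <= (al + 1) * Gamma (1 - al) * fine I.
  have {}L := L (eventually_filter).
  rewrite -(cvg_lim _ L)//; apply: limr_le; first by apply/cvg_ex; eexists; exact: L.
  exact: nearW.
rewrite normrM normrN (gtr0_norm alc0) => H.
rewrite -(fineK If) -EFinM lee_fin mulrAC ler_pdivlMr// mulrC.
by [].
Qed.

End kernel_limits.

(** * The Sobolev inequality *)

Section ae_bound.
Context {R : realType}.
Notation mu := (@lebesgue_measure R).

Section riesz_finite.
Context (a p : R) (f : R -> R).
Hypotheses (a0 : (0 : R) < a) (a1 : a < (1 : R)) (p1 : (1 : R) < p) (ap : a * p < (1 : R)).
Hypotheses (mf : measurable_fun setT f) (f0 : forall x, 0 <= f x).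
Hypothesis fy : ('N[mu]_(p%:E)[EFin \o f] < +oo)%E.

Let q := p / (1 - a * p).

Let q1 : (1 : R) < q.
Proof.
rewrite /q ltr_pdivlMr ?subr_gt0// mul1r (lt_le_trans _ (ltW p1))//.
by rewrite ltrBlDr ltrDl mulr_gt0// (lt_trans _ p1).
Qed.

Let q0 : (0 : R) < q. Proof. exact: lt_trans q1. Qed.

Let mr := measurable_riesz a f0 mf.

Let mrq : measurable_fun setT (fun x => riesz a f x `^ q)%E.
Proof. exact: (measurableT_comp (measurable_poweR _)). Qed.

Let rqy : (\int[mu]_x (riesz a f x `^ q) < +oo)%E.
Proof.
have [C C0 CP] := hardy_littlewood_sobolev a0 a1 p1 ap.
have : ('N[mu]_(q%:E)[riesz a f] < +oo)%E.
  by apply: le_lt_trans (CP f mf f0) _; rewrite lte_mul_pinfty ?lee_fin ?(ltW C0).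
rewrite unlock => /lty_poweRy; rewrite invr_eq0 gt_eqF// => /(_ erefl).
by under eq_integral do rewrite gee0_abs ?riesz_ge0//.
Qed.

Lemma riesz_fin_num_ae : {ae mu, forall x, riesz a f x \is a fin_num}.
Proof.
have irq : mu.-integrable setT (fun x => riesz a f x `^ q)%E.
  apply/integrableP; split => //.
  by under eq_integral do rewrite gee0_abs ?poweR_ge0//.
have := integrable_ae measurableT irq; apply: filterS => x /(_ I).
have := riesz_ge0 a f0 x; case: (riesz a f x) => //= _.
by rewrite gt_eqF.
Qed.

(** The potential has finite norm for the exponent [q > 1], hence is locally integrable; [fine]
    alters it only where it is infinite, which is a null set. *)
Lemma locally_integrable_riesz : locally_integrable setT (fine \o riesz a f).
Proof.
have If : (\int[mu]_x (riesz a f x `^ q))%E \is a fin_num.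
  by rewrite ge0_fin_numE// integral_ge0// => x _; exact: poweR_ge0.
have mfr : measurable_fun setT (fine \o riesz a f).
  by apply: measurableT_comp => //; exact: fine_measurable.
apply: (@locally_integrable_Lp _ q _ q1 _ _ (fine (\int[mu]_x (riesz a f x `^ q))%E)) => //.
- by move=> x; rewrite fine_ge0 ?riesz_ge0.
- rewrite fineK//; apply: ge0_le_integralT => //.
  + apply/measurable_EFinP.
    exact: (measurableT_comp (measurable_powR _)).
  + by move=> x; rewrite lee_fin powR_ge0.
  + move=> x /=; have := riesz_ge0 a f0 x; case: (riesz a f x) => [r _| _|] //=.
    by rewrite powR0 ?gt_eqF// leey.
Qed.

End riesz_finite.

(** Differentiation is stated with balls, the estimates with [[a, b[]. The closed left end requires
    an open ball larger than the interval; doubling the radius makes the ratio of the measures 2. *)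
Lemma nicely_shrinking_itv (x : R) :
  nicely_shrinking x (fun n => `[x - n.+1%:R^-1, x + n.+1%:R^-1[%classic).
Proof.
have e0 n : (0 : R) < 2 * n.+1%:R^-1 by rewrite mulr_gt0.
split => //; exists (2, fun n => PosNum (e0 n)); split => //=.
- by rewrite -[X in _ --> X](mulr0 2); apply: cvgM; [exact: cvg_cst|exact: cvg_harmonic].
- move=> n y /=; rewrite in_itv/= ball_itv/= in_itv/= => /andP[h1 h2].
  have : (0 : R) < n.+1%:R^-1 by [].
  move: n.+1%:R^-1 h1 h2 => e h1 h2 e1.
  by apply/andP; split; lra.
- move=> n; rewrite lebesgue_measure_ball ?(ltW (e0 n))//.
  have : (0 : R) < n.+1%:R^-1 by [].
  move: n.+1%:R^-1 => e e1; rewrite [X in (_ * X)%E](lebesgue_measure_itv `[_, _[)/= lte_fin.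
  rewrite ifT; last by lra.
  by rewrite -EFinB -EFinM lee_fin; lra.
Qed.

(** At a common Lebesgue point of [u] and [g], divide by the length of shrinking intervals and pass
    to the limit. *)
Lemma ae_norm_le_of_integral_le (u g : R -> R) (C : R) : 0 <= C ->
  locally_integrable setT u -> locally_integrable setT g ->
  (forall a b, a <= b -> (`|\int[mu]_(x in `[a, b[) (u x)%:E| <=
     C%:E * \int[mu]_(x in `[a, b[) (g x)%:E)%E) ->
  {ae mu, forall x, `|u x| <= C * g x}.
Proof.
move=> C0 lu lg ug.
have H1 := lebesgue_differentiation lu; have H2 := lebesgue_differentiation lg.
have aeF := ae_filter_ringOfSetsType mu.
apply: (filterS2 _ _ H1 H2) => x ux gx.
have {}ux := nice_lebesgue_differentiation nicely_shrinking_itv lu ux.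
have {}gx := nice_lebesgue_differentiation nicely_shrinking_itv lg gx.
have {}ux := cvg_abse ux; have {}ux := ux eventually_filter.
have {}gx := cvgeZl (isT : C%:E \is a fin_num) gx.
rewrite -lee_fin.
have -> : (`|u x|%:E = `|(u x)%:E|)%E by [].
rewrite EFinM -(cvg_lim _ ux)// -(cvg_lim _ gx)//.
apply: lee_lim; [by apply/cvg_ex; eexists; exact: ux|by apply/cvg_ex; eexists; exact: gx|].
apply: nearW => n.
rewrite abseM gee0_abs ?inve_ge0// muleCA lee_wpmul2l ?inve_ge0//; apply: ug.
by rewrite lerBlDr -addrA lerDl addr_ge0.
Qed.
Lemma Lnorm_ae_le (q C : R) (f : R -> R) (g : R -> \bar R) : 0 < q -> 0 < C ->
  measurable_fun setT f -> measurable_fun setT g -> (forall x, 0 <= g x)%E ->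
  {ae mu, forall x, (`|f x|%:E <= C%:E * g x)%E} ->
  ('N[mu]_(q%:E)[EFin \o f] <= C%:E * 'N[mu]_(q%:E)[g])%E.
Proof.
move=> q0 C0 mf mg g0 fg.
have -> : (C%:E = (C%:E `^ q) `^ q^-1)%E.
  by rewrite !poweR_EFin -powRrM mulfV ?gt_eqF// powRr1// ltW.
have I0 : (0 <= \int[mu]_x (`|g x| `^ q))%E.
  by apply: integral_ge0 => x _; exact: poweR_ge0.
rewrite unlock -poweRM ?poweR_ge0//.
apply: le_poweR; rewrite ?invr_ge0 ?(ltW q0)//.
  by apply: integral_ge0 => x _; exact: poweR_ge0.
have mgq : measurable_fun setT (fun x => `|g x| `^ q)%E.
  by apply: (measurableT_comp (measurable_poweR _)); exact: measurableT_comp.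
rewrite poweR_EFin -ge0_integralTZl ?powR_ge0//; last by move=> x; exact: poweR_ge0.
apply: ae_ge0_le_integral => //.
- by move=> x _; exact: poweR_ge0.
- apply: (measurableT_comp (measurable_poweR _)); apply: measurableT_comp => //.
  exact/measurable_EFinP.
- by move=> x _; rewrite mule_ge0 ?poweR_ge0// lee_fin powR_ge0.
- exact: measurable_funeM.
have aeF := ae_filter_ringOfSetsType mu.
apply: filterS fg => x fgx _ /=.
rewrite gee0_abs// -!poweR_EFin -poweRM ?lee_fin ?(ltW C0)//.
by apply: le_poweR; rewrite ?(ltW q0).
Qed.

Lemma Lnorm_opp (p : R) (f : R -> R) : measurable_fun setT f ->
  ('N[mu]_(p%:E)[EFin \o (f \o -%R)] = 'N[mu]_(p%:E)[EFin \o f])%E.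
Proof.
move=> mf; pose F x := (`|(f x)%:E| `^ p)%E.
have mF : measurable_fun setT F.
  apply: (measurableT_comp (measurable_poweR _)); apply: measurableT_comp => //.
  exact/measurable_EFinP.
by rewrite unlock; apply: (congr1 (fun I => I `^ p^-1)%E); exact: (integral_reflect mF).
Qed.

(** The part common to both signs: of the weak derivative only the identities against the
    approximations are kept. The constant is fixed before [u] and [v]. *)
Theorem Lnorm_le_of_bump (al p : R) : (0 : R) < al -> al < (1 : R) -> (1 : R) < p ->
  al * p < (1 : R) ->
  exists2 C : R, 0 < C & forall u v : R -> R,
    mu.-integrable setT (EFin \o u) -> measurable_fun setT v ->
    (forall a b n, a <= b -> \int[mu]_x (v x * bump_fun al a b n x) =
       \int[mu]_x (u x * (- (Gamma (1 - al))^-1 * kbump al a b n x))) ->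
    ('N[mu]_((p / (1 - al * p))%:E)[EFin \o u] <= C%:E * 'N[mu]_(p%:E)[EFin \o v])%E.
Proof.
move=> al0 al1 p1 alp.
have [C1 C10 C1P] := hardy_littlewood_sobolev al0 al1 p1 alp.
set C2 := (al + 1) * Gamma (1 - al) / (al * fine (beta_cst al)).
have C20 : 0 < C2.
  by rewrite divr_gt0 ?mulr_gt0 ?addr_gt0 ?Gamma_gt0// fine_gt0// beta_cst_gt0// beta_cst_lty.
exists (C2 * C1); first exact: mulr_gt0.
move=> u v iu mv uv.
have [->|vy] := eqVneq ('N[mu]_(p%:E)[EFin \o v])%E +oo%E.
  by rewrite gt0_muley ?leey// lte_fin mulr_gt0.
pose w (x : R) : R := `|v x|.
have w0 x : 0 <= w x by exact: normr_ge0.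
have mw : measurable_fun setT w by exact: measurableT_comp.
have wE : ('N[mu]_(p%:E)[EFin \o w] = 'N[mu]_(p%:E)[EFin \o v])%E by rewrite -[RHS]Lnorm_abse.
have wy : ('N[mu]_(p%:E)[EFin \o w] < +oo)%E by rewrite wE ltey.
have mr := measurable_riesz al w0 mw.
have mfr : measurable_fun setT (fine \o riesz al w).
  by apply: measurableT_comp => //; exact: fine_measurable.
have aeF := ae_filter_ringOfSetsType mu.
have bound : {ae mu, forall x, `|u x| <= C2 * fine (riesz al w x)}.
  apply: ae_norm_le_of_integral_le; first exact: ltW.
  - by apply: open_integrable_locally => //; exact: openT.
  - exact: locally_integrable_riesz wy.
  - move=> a b ab.
    have -> : (\int[mu]_(x in `[a, b[) (fine (riesz al w x))%:E =
               \int[mu]_(x in `[a, b[) riesz al w x)%E.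
      apply: ae_eq_integral => //.
      + by apply: measurable_funTS; exact/measurable_EFinP.
      + exact: measurable_funTS.
      + by apply: filterS (riesz_fin_num_ae al0 al1 p1 alp mw w0 wy) => x rx _; rewrite fineK.
    apply: le_trans (Rintegral_itv_le al0 al1 ab iu mv (fun n => uv a b n ab)).
    rewrite /Rintegral; have : (\int[mu]_(x in `[a, b[) (u x)%:E)%E \is a fin_num.
      by apply: integrable_fin_num => //; exact: integrableS iu.
    by move=> /fineK {1}<-.
have q0 : 0 < p / (1 - al * p) by rewrite divr_gt0 ?subr_gt0// (lt_trans _ p1).
have r0 := riesz_ge0 al w0.
apply: le_trans (@Lnorm_ae_le _ C2 _ (riesz al w) q0 C20 _ mr r0 _) _.
- by apply/measurable_EFinP; exact: measurable_int iu.
- apply: filterS bound => x ux.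
  apply: (@le_trans _ _ (C2 * fine (riesz al w x))%:E); first by rewrite lee_fin.
  rewrite EFinM lee_wpmul2l ?lee_fin ?(ltW C20)//.
  by move: (r0 x); case: (riesz al w x) => //= _; rewrite leey.
by rewrite (EFinM C2) -muleA -wE; apply: lee_wpmul2l; [rewrite lee_fin ltW|exact: C1P].
Qed.

End ae_bound.

Unset Implicit Arguments.

Theorem theorem4p23 (R : realType) (alpha p : R)
    (alpha0 : 0 < alpha) (alpha1 : alpha < 1)
    (p1 : 1 < p) (palpha : p < alpha^-1) (s : side) :
  exists2 C : R, 0 < C &
    forall u v : R -> R,
      u \in Lfun lebesgue_measure 1%:E ->
      frac_sobolev s alpha p u ->
      weak_frac_deriv s alpha u v ->
      ('N[lebesgue_measure]_((p / (1 - alpha * p))%:E)[EFin \o u] <=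
       C%:E * 'N[lebesgue_measure]_(p%:E)[EFin \o v])%E.
Proof.
have alp : alpha * p < 1 by rewrite mulrC -ltr_pdivlMr// div1r.
have [C C0 CP] := Lnorm_le_of_bump alpha0 alpha1 p1 alp.
exists C => // u v /Lfun1_integrable iu _ [[mv _ _] uv].
case: s uv => uv.
  (* For the sign [-] the approximations themselves are the test functions. *)
  apply: CP => // a b n ab; rewrite uv; last exact: test_function_bump.
  by apply: eq_Rintegral => x _; rewrite frac_deriv_bump.
have mu' : measurable_fun setT u by apply/measurable_EFinP; exact: measurable_int iu.
have mN : measurable_fun setT (-%R : R -> R) by exact: oppr_measurable.
have mvN : measurable_fun setT (v \o -%R) by exact: measurableT_comp.
(* For the sign [+] the common part is applied to the reflections of [u] and [v], which have the
   same norms; their identities are those of [u] and [v] against reflected approximations. *)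
rewrite -(Lnorm_opp p mv) -(Lnorm_opp _ mu'); apply: CP => //.
  apply/integrableP; split; first by apply/measurable_EFinP; exact: measurableT_comp.
  have /integrableP[_] := iu.
  rewrite -integral_reflect//.
  by apply: measurableT_comp => //; exact/measurable_EFinP.
move=> a b n ab.
have mb := @measurable_bump _ alpha a b n.
have mk := @measurable_kbump _ alpha a b n.
have muk : measurable_fun setT
    (fun x => u x * (- (Gamma (1 - alpha))^-1 * kbump alpha a b n (- x))).
  exact: (measurable_funM mu' (measurable_funM (measurable_cst _) (measurableT_comp mk mN))).
transitivity (\int[lebesgue_measure]_x (v x * (bump_fun alpha a b n \o -%R) x)).
  rewrite [RHS]Rintegral_opp; last by apply: measurable_funM => //; exact: measurableT_comp.
  by apply: eq_Rintegral => x _; rewrite /= opprK.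
rewrite uv; last exact: test_function_bump_opp.
transitivity (\int[lebesgue_measure]_x
    (u x * (- (Gamma (1 - alpha))^-1 * kbump alpha a b n (- x)))).
  by apply: eq_Rintegral => x _; rewrite frac_deriv_bump_opp.
apply: etrans (Rintegral_opp muk) _.
by apply: eq_Rintegral => x _; rewrite opprK.
Qed.
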